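(* Let $n\ge1$ and let $J$ be a nontrivial and proper $M$-ideal in $H^\infty(\mathbb{D}^n)$. Then no inner function belongs to $J$.
   Context: $\mathbb{D}$ is the open unit disc in $\mathbb{C}$, $\mathbb{T}$ the unit circle, and $H^\infty(\mathbb{D}^n)$ is the Banach algebra of bounded holomorphic functions on $\mathbb{D}^n$ with the supremum norm. For $f\in H^\infty(\mathbb{D}^n)$, $\tilde f(z)=\lim_{r\to1^-}f(rz)$ denotes the radial limit function, defined for almost every $z\in\mathbb{T}^n$. A function $\upsilon\in H^\infty(\mathbb{D}^n)$ is inner if $|\tilde\upsilon(z)|=1$ for almost every $z\in\mathbb{T}^n$. $M$-ideal: a closed subspace $C$ of a complex Banach space $X$ is an $M$-ideal in $X$ if there is a bounded linear projection $P:X^*\to X^*$ ($P^2=P$) with $\operatorname{ran}P=C^\perp=\{x^*\in X^*: x^*|_C\equiv0\}$ and $\|Px^*\|+\|(I-P)x^*\|=\|x^*\|$ for all $x^*\in X^*$. ''Proper'' means $\neq H^\infty(\mathbb{D}^n)$ and ''nontrivial'' means $\neq\{0\}$. *)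

(* Defs.v *)
From HB Require Import structures.
From mathcomp Require Import all_boot all_order all_algebra.
From mathcomp Require Import all_classical all_reals all_analysis.
From mathcomp Require Import complex.

Set Implicit Arguments.
Unset Strict Implicit.
Unset Printing Implicit Defensive.

Import Order.TTheory GRing.Theory Num.Def Num.Theory.
Import numFieldNormedType.Exports.

Local Open Scope classical_set_scope.
Local Open Scope ring_scope.

(* R[i] itself has no canonical topology; a term of type numClosedFieldType
   gets the one induced by its norm. *)
Definition cplx (R : realType) : numClosedFieldType := R[i].

(* [`|z|] lies in cplx R; modulus z is the same number in R. *)
Definition modulus (R : realType) (z : cplx R) : R := complex.Re `|z|.

Definition sup_norm (R : realType) (T : Type) (A : set T) (f : T -> cplx R) : R :=
  sup [set modulus (f x) | x in A].

Section sup_norm_theory.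
Context (R : realType).
Local Notation C := (cplx R).

Lemma modulusE (z : C) : (modulus z)%:C%C = `|z|.
Proof. by rewrite /modulus; case: z => a b; rewrite normc_def. Qed.

Lemma modulus_ge0 (z : C) : 0 <= modulus z.
Proof. by have := normr_ge0 z; rewrite -modulusE (ler0c (modulus z)). Qed.

Lemma modulus_le (z w : C) : (modulus z <= modulus w) = (`|z| <= `|w|).
Proof. by rewrite -!modulusE lecR. Qed.

Lemma modulusD (z w : C) : modulus (z + w) <= modulus z + modulus w.
Proof.
by rewrite -lecR (rmorphD (real_complex R)) /= !modulusE; exact: ler_normD.
Qed.

Lemma modulusM (z w : C) : modulus (z * w) = modulus z * modulus w.
Proof.
by apply: (@complexI R); rewrite (rmorphM (real_complex R)) /= !modulusE normrM.
Qed.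

Lemma modulus0_eq0 (z : C) : modulus z = 0 -> z = 0.
Proof.
by move=> z0; apply/eqP; rewrite -normr_eq0 -modulusE z0.
Qed.

Lemma modulus0 : modulus (0 : C) = 0.
Proof. by rewrite /modulus normr0. Qed.

Context (T : Type) (A : set T).
Implicit Types f g : T -> C.

Definition bounded_on f := exists M : R, forall x, A x -> modulus (f x) <= M.

Lemma sup_norm_ub f x : bounded_on f -> A x -> modulus (f x) <= sup_norm A f.
Proof.
move=> [M fM] Ax; apply: sup_upper_bound; last by exists x.
split; first by exists (modulus (f x)); exists x.
by exists M => _ [y Ay <-]; exact: fM.
Qed.

Lemma sup_norm_ge0 f : 0 <= sup_norm A f.
Proof.
have [[[y [x Ax _]] ubA]|/sup_out supA] := pselect (has_sup
  [set modulus (f x) | x in A]); last by rewrite /sup_norm supA.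
rewrite (le_trans (modulus_ge0 (f x)))//.
by apply: sup_upper_bound; [split=> //; exists (modulus (f x)); exists x|exists x].
Qed.

Lemma sup_norm_le f (M : R) : 0 <= M ->
  (forall x, A x -> modulus (f x) <= M) -> sup_norm A f <= M.
Proof.
move=> M0 fM; have [->|/set0P A0] := eqVneq A set0.
  by rewrite /sup_norm image_set0 sup0.
apply: ge_sup; first by case: A0 => x Ax; exists (modulus (f x)); exists x.
by move=> _ [x Ax <-]; exact: fM.
Qed.

Lemma sup_normD f g : bounded_on f -> bounded_on g ->
  sup_norm A (fun x => f x + g x) <= sup_norm A f + sup_norm A g.
Proof.
move=> bf bg; apply: sup_norm_le => [|x Ax].
  by rewrite addr_ge0 ?sup_norm_ge0.
by rewrite (le_trans (modulusD _ _))// lerD ?sup_norm_ub.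
Qed.

Lemma bounded_onZ (l : C) f : bounded_on f -> bounded_on (fun x => l * f x).
Proof.
move=> [M fM]; exists (modulus l * M) => x Ax.
by rewrite modulusM ler_wpM2l ?modulus_ge0 ?fM.
Qed.

Lemma bounded_onD f g :
  bounded_on f -> bounded_on g -> bounded_on (fun x => f x + g x).
Proof.
move=> [M fM] [N gN]; exists (M + N) => x Ax.
by rewrite (le_trans (modulusD _ _))// lerD ?fM ?gN.
Qed.

Lemma sup_normZ (l : C) f : bounded_on f ->
  sup_norm A (fun x => l * f x) = modulus l * sup_norm A f.
Proof.
move=> bf; apply/eqP; rewrite eq_le; apply/andP; split.
  apply: sup_norm_le => [|x Ax]; first by rewrite mulr_ge0 ?modulus_ge0 ?sup_norm_ge0.
  by rewrite modulusM ler_wpM2l ?modulus_ge0 ?sup_norm_ub.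
have [l0|l0] := eqVneq (modulus l) 0.
  by rewrite l0 mul0r sup_norm_ge0.
have lp : 0 < modulus l by rewrite lt_neqAle eq_sym l0 modulus_ge0.
rewrite mulrC -ler_pdivlMr//; apply: sup_norm_le => [|x Ax].
  by rewrite divr_ge0 ?sup_norm_ge0 ?modulus_ge0.
rewrite ler_pdivlMr// mulrC -modulusM.
by apply: (sup_norm_ub (f := fun x => l * f x)) => //; exact: bounded_onZ.
Qed.

Lemma sup_norm0_eq0 f : bounded_on f -> sup_norm A f = 0 ->
  forall x, A x -> f x = 0.
Proof.
move=> bf f0 x Ax; apply: modulus0_eq0; apply/eqP.
by rewrite eq_le modulus_ge0 andbT -f0 sup_norm_ub.
Qed.

End sup_norm_theory.

(* X^* is the space of continuous linear functionals; [dual_norm] below is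
   the operator norm, as an element of the scalar field. *)
Definition is_dual (R : realType) (X : normedModType (cplx R))
    : {pred X -> cplx R} :=
  [pred phi : X -> cplx R | `[< scalar phi /\ continuous phi >]].

Record dual (R : realType) (X : normedModType (cplx R)) :=
  Dual { dual_fun :> X -> cplx R ; _ : dual_fun \in @is_dual R X }.

HB.instance Definition _ (R : realType) (X : normedModType (cplx R)) :=
  [isSub of dual X for @dual_fun R X].
HB.instance Definition _ (R : realType) (X : normedModType (cplx R)) :=
  [Choice of dual X by <:].

Section dual_normed.
Context (R : realType) (X : normedModType (cplx R)).
Local Notation C := (cplx R).

Fact is_dual_submod : submod_closed (@is_dual R X).
Proof.
split=> [|a f g].
  apply/asboolP; split; last exact: cst_continuous.
  by move=> b x y; rewrite -[LHS]/(0 : C) -[RHS]/(b * 0 + 0 : C) mulr0 addr0.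
move=> /asboolP[lf cf] /asboolP[lg cg]; apply/asboolP; split.
  move=> b x y.
  rewrite -[LHS]/(a * f (b *: x + y) + g (b *: x + y)).
  rewrite -[RHS]/(b * (a * f x + g x) + (a * f y + g y)) lf lg !mulrDr !mulrA.
  by rewrite [b * a]mulrC addrACA.
move=> x; apply: cvgD; last exact: cg.
by apply: cvgZl_tmp; exact: cf.
Qed.

HB.instance Definition _ :=
  GRing.isSubmodClosed.Build C (X -> C) (@is_dual R X) is_dual_submod.
HB.instance Definition _ := [SubChoice_isSubLmodule of dual X by <:].

Lemma dualP (phi : dual X) : scalar phi /\ continuous phi.
Proof. by case: phi => f /= /asboolP. Qed.

Definition unit_ball : set X := [set x | `|x| <= 1].

Lemma dual_bounded (phi : dual X) : bounded_on unit_ball phi.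
Proof.
have [lphi cphi] := dualP phi.
pose mphi := GRing.isLinear.Build C X C *%R phi lphi.
pose f : {linear X -> C^o} := HB.pack (phi : X -> C^o) mphi.
have /bounded_funP : bounded_near f (nbhs (0 : X)).
  by apply: continuous_linear_bounded; exact: cphi.
move=> /(_ 1)[M fM]; exists (modulus M) => x x1.
rewrite modulus_le (le_trans (fM _ x1))//.
by rewrite real_ler_norm// (ger0_real (le_trans _ (fM _ x1))).
Qed.

Definition dual_norm (phi : dual X) : C := (sup_norm unit_ball phi)%:C%C.

Fact dual_normD phi psi : dual_norm (phi + psi) <= dual_norm phi + dual_norm psi.
Proof.
rewrite /dual_norm -(rmorphD (real_complex R)) lecR.
by apply: sup_normD; exact: dual_bounded.
Qed.

Fact dual_normZ l phi : dual_norm (l *: phi) = `|l| * dual_norm phi.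
Proof.
rewrite /dual_norm -modulusE -(rmorphM (real_complex R)).
by congr (_%:C)%C; apply: sup_normZ; exact: dual_bounded.
Qed.

Fact dual_norm0_eq0 phi : dual_norm phi = 0 -> phi = 0.
Proof.
move=> /(@complexI R) phi0; apply/val_inj/funext => x /=.
have [lphi _] := dualP phi.
have {}phi0 := sup_norm0_eq0 (dual_bounded phi) phi0.
have [->|x0] := eqVneq x 0.
  by apply: phi0; rewrite /unit_ball/= normr0.
have phiZ a y : phi (a *: y) = a * phi y.
  have phi00 : phi 0 = 0 by apply: phi0; rewrite /unit_ball/= normr0.
  by have := lphi a y 0; rewrite addr0 phi00 addr0.
have nx0 : `|x| != 0 by rewrite normr_eq0.
have : phi (`|x|^-1 *: x) = 0.
  by apply: phi0; rewrite /unit_ball/= normrZ normfV normr_id mulVf.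
by rewrite phiZ => /eqP; rewrite mulf_eq0 invr_eq0 (negbTE nx0) => /eqP.
Qed.

HB.instance Definition _ := @Lmodule_isNormed.Build C (dual X)
  dual_norm dual_normD dual_normZ dual_norm0_eq0.

End dual_normed.

Definition annihilator (R : realType) (X : normedModType (cplx R)) (J : set X)
    : set (dual X) :=
  [set phi : dual X | forall x, J x -> phi x = 0].

Definition closed_subspace (R : realType) (X : normedModType (cplx R))
    (J : set X) : Prop :=
  [/\ closed J, J 0 & forall (a : cplx R) x y, J x -> J y -> J (a *: x + y)].

(* Completeness of X plays no role in the definition. Norms are compared in
   cplx R, where they are nonnegative reals. *)
Definition M_ideal (R : realType) (X : normedModType (cplx R)) (J : set X)
    : Prop :=
  closed_subspace J /\
  exists P : {linear dual X -> dual X},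
    [/\ continuous P,
        forall phi, P (P phi) = P phi,
        range P = annihilator J &
        forall phi, `|P phi| + `|phi - P phi| = `|phi| ].

Definition polydisc (R : realType) (n : nat) : set 'rV[cplx R]_n :=
  [set z | forall j, `|z ord0 j| < 1].

(* Holomorphic means complex differentiable at every point of D^n (K = C in
   [differentiable]). Functions on D^n are represented by total functions on C^n that vanish
   off D^n, so that equality in Hinf is equality on D^n. *)
Definition is_Hinf (R : realType) (n : nat) : {pred 'rV[cplx R]_n -> cplx R} :=
  [pred f : 'rV[cplx R]_n -> cplx R | `[< [/\ forall z, polydisc z -> differentiable f z,
                    bounded_on (@polydisc R n) f &
                    forall z, ~ polydisc z -> f z = 0] >]].

Record Hinf (R : realType) (n : nat) := MkHinf
  { Hinf_fun :> 'rV[cplx R]_n -> cplx R ; _ : Hinf_fun \in @is_Hinf R n }.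

HB.instance Definition _ (R : realType) (n : nat) :=
  [isSub of Hinf R n for @Hinf_fun R n].
HB.instance Definition _ (R : realType) (n : nat) := [Choice of Hinf R n by <:].

Section Hinf_normed.
Context (R : realType) (n : nat).
Local Notation C := (cplx R).

Fact is_Hinf_submod : submod_closed (@is_Hinf R n).
Proof.
split=> [|a f g].
  apply/asboolP; split => //.
  by exists 0 => z _; rewrite -[0 z]/(0 : C) modulus0.
move=> /asboolP[df bf f0] /asboolP[dg bg g0]; apply/asboolP; split.
- move=> z Dz; apply: differentiableD; last exact: dg.
  by apply: differentiableZ; exact: df.
- by apply: bounded_onD => //; exact: bounded_onZ.
- move=> z Dz; rewrite -[LHS]/(a * f z + g z).
  by rewrite f0// g0// mulr0 addr0.
Qed.

HB.instance Definition _ := GRing.isSubmodClosed.Build C ('rV[C]_n -> C)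
  (@is_Hinf R n) is_Hinf_submod.
HB.instance Definition _ := [SubChoice_isSubLmodule of Hinf R n by <:].

Lemma HinfP (f : Hinf R n) :
  [/\ forall z, polydisc z -> differentiable f z,
      bounded_on (@polydisc R n) f & forall z, ~ polydisc z -> f z = 0].
Proof. by case: f => f /= /asboolP. Qed.

Lemma Hinf_bounded (f : Hinf R n) : bounded_on (@polydisc R n) f.
Proof. by have [] := HinfP f. Qed.

Definition Hinf_norm (f : Hinf R n) : C := (sup_norm (@polydisc R n) f)%:C%C.

Fact Hinf_normD f g : Hinf_norm (f + g) <= Hinf_norm f + Hinf_norm g.
Proof.
rewrite /Hinf_norm -(rmorphD (real_complex R)) lecR.
by apply: sup_normD; exact: Hinf_bounded.
Qed.

Fact Hinf_normZ l f : Hinf_norm (l *: f) = `|l| * Hinf_norm f.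
Proof.
rewrite /Hinf_norm -modulusE -(rmorphM (real_complex R)).
by congr (_%:C)%C; apply: sup_normZ; exact: Hinf_bounded.
Qed.

Fact Hinf_norm0_eq0 f : Hinf_norm f = 0 -> f = 0.
Proof.
move=> /(@complexI R) f0; apply/val_inj/funext => z /=.
have [_ bf fD] := HinfP f.
by have [Dz|/fD//] := pselect (polydisc z); exact: sup_norm0_eq0 Dz.
Qed.

HB.instance Definition _ := @Lmodule_isNormed.Build C (Hinf R n)
  Hinf_norm Hinf_normD Hinf_normZ Hinf_norm0_eq0.

End Hinf_normed.

Definition tuple_cons (R : realType) (n : nat)
    (p : measurableTypeR R * n.-tuple (measurableTypeR R))
    : n.+1.-tuple (measurableTypeR R) := [the n.+1.-tuple _ of p.1 :: p.2].

Fact measurable_tuple_cons (R : realType) (n : nat) :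
  measurable_fun setT (@tuple_cons R n).
Proof. exact: measurable_cons. Qed.

HB.instance Definition _ (R : realType) (n : nat) :=
  isMeasurableFun.Build _ _ _ _ (@tuple_cons R n) (@measurable_tuple_cons R n).

Fact two_pi_gt0 (R : realType) : 0 < 2 * pi :> R.
Proof. by rewrite mulr_gt0 ?pi_gt0. Qed.

(* The n-fold product of the uniform probability on [0, 2 pi]. Through
   [torus_point] below it is the normalized Lebesgue measure on T^n. *)
Fixpoint angle_measure (R : realType) (n : nat)
    : probability (n.-tuple (measurableTypeR R)) R :=
  if n is n'.+1
  then distribution (uniform_prob (two_pi_gt0 R) \x angle_measure R n')%E
         (@tuple_cons R n')
  else dirac [tuple].

Definition torus_point (R : realType) (n : nat)
    (t : n.-tuple (measurableTypeR R)) : 'rV[cplx R]_n :=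
  \row_j (cos (tnth t j) +i* sin (tnth t j))%C.

Definition radial (R : realType) (n : nat) (f : 'rV[cplx R]_n -> cplx R)
    (z : 'rV[cplx R]_n) (r : R) : cplx R := f ((r%:C%C : cplx R) *: z).

Definition radial_limit (R : realType) (n : nat) (f : 'rV[cplx R]_n -> cplx R)
    (z : 'rV[cplx R]_n) : cplx R := lim (radial f z r @[r --> 1^'-]).

(* [lim] is total, so the existence of the radial limit is required as well. *)
Definition inner (R : realType) (n : nat) (f : Hinf R n) : Prop :=
  {ae angle_measure R n, forall t,
     cvg (radial f (torus_point t) r @[r --> 1^'-]) /\
     `|radial_limit f (torus_point t)| = 1}.

(* Main.v *)
Require Import Defs.
From mathcomp Require Import all_boot all_order all_algebra.
From mathcomp Require Import all_classical all_reals all_analysis.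
From mathcomp Require Import complex measurable_realfun ring lra.

Set Implicit Arguments.
Unset Strict Implicit.
Unset Printing Implicit Defensive.

Import Order.TTheory GRing.Theory Num.Def Num.Theory.
Import numFieldNormedType.Exports.

Local Open Scope classical_set_scope.
Local Open Scope ring_scope.

(** Suppose an inner function [u] belongs to the M-ideal [J]. The proof shows
    that [J] is then dense, hence everything, by combining a property of
    M-ideals in arbitrary normed spaces with a maximum principle on the torus.

    The M-ideal property is used in the form of a two-ball property
    ([M_ideal_two_ball]): if [f] has norm at most [1] and [u] is in the unit
    ball of [J], then for every [eps > 0] some [e] in [J] satisfies
    [|f + u - e| < 1 + eps] and [|f - u - e| < 1 + eps]. Indeed the distance in
    [X * X], with the maximum norm, from [(f + u, f - u)] to the diagonal copy
    of [J] is attained by a functional [(p, q)] with [|p| + |q| <= 1] and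
    [p + q] in the annihilator of [J] (Hahn-Banach). If [P] is the L-projection
    then [P (p + q) = p + q], and [P p], [P q] vanish at [u], so the value
    [(p + q) f + (p - q) u] of the functional is bounded by
    [|P p| + |P q| + |p - P p| + |q - P q| = |p| + |q| <= 1].

    With [g = f - e] the parallelogram law turns the two inequalities into
    [|g|^2 + |u|^2 <= (1 + eps)^2] at every point of the polydisc. Near the
    torus [|u|] tends to [1], so there [|g|^2] should be at most
    [2 eps + eps^2], and by a maximum principle this bound should hold
    everywhere ([inner_two_ball]). As [eps] is arbitrary, [J] is dense in the
    unit ball.

    The maximum principle must tolerate a null set of bad boundary points, so it
    goes through integrals ([boundary_bound]): for holomorphic [f] and a point
    [a] there is a constant [K] with [|f a| <= K * (mean of |f| over the torus of
    radius r)] for all [r] close to [1]. Applied to the powers [f ^ m] and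
    combined with dominated convergence as [r] tends to [1], it gives
    [|f a|^m <= K L^m] as soon as [|f|] is dominated by a bounded function with
    radial limits [L]; letting [m] grow removes the constant.

    The mean estimate is Cauchy's formula in one variable ([cauchy_bound]),
    iterated with Tonelli's theorem ([torus_bound]). Since holomorphy only means
    pointwise complex differentiability here, Cauchy's formula needs Goursat's
    argument; it is carried out for a real form [A dx + B ds] on a rectangle,
    closed at every point in a pointwise sense ([closed_form_rectangle]). *)

(** * Complex moduli and the unit circle *)

Section complex_facts.
Context (R : realType).
Local Notation C := (cplx R).
Implicit Types (z w : C) (s t : R).

Lemma Re_le_modulus z : `|complex.Re z| <= modulus z.
Proof. by rewrite -lecR modulusE; exact: normc_ge_Re. Qed.

Lemma modulus_sq z : modulus z ^+ 2 = complex.Re z ^+ 2 + complex.Im z ^+ 2.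
Proof. by case: z => x y; rewrite /modulus normc_def /= sqr_sqrtr// addr_ge0 ?sqr_ge0. Qed.

Lemma Im_le_modulus z : `|complex.Im z| <= modulus z.
Proof.
rewrite -(@ler_pXn2r _ 2)// ?nnegrE ?modulus_ge0// modulus_sq real_normK ?num_real//.
by rewrite lerDr sqr_ge0.
Qed.

Lemma modulus_le_ReIm z : modulus z <= `|complex.Re z| + `|complex.Im z|.
Proof.
rewrite -(@ler_pXn2r _ 2)// ?nnegrE ?modulus_ge0 ?addr_ge0//.
rewrite modulus_sq sqrrD !real_normK ?num_real//.
by rewrite addrAC lerDl mulrn_wge0// mulr_ge0.
Qed.

Lemma modulusN z : modulus (- z) = modulus z.
Proof. by rewrite /modulus normrN. Qed.

Lemma modulusB z w : modulus (z - w) <= modulus z + modulus w.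
Proof. by rewrite (le_trans (modulusD _ _))// modulusN. Qed.

Lemma modulus_distC z w : modulus (z - w) = modulus (w - z).
Proof. by rewrite -modulusN opprB. Qed.

Lemma modulusV z : modulus z^-1 = (modulus z)^-1.
Proof. by apply: (@complexI R); rewrite modulusE normfV fmorphV/= modulusE. Qed.

Lemma modulusX z n : modulus (z ^+ n) = modulus z ^+ n.
Proof. by apply: (@complexI R); rewrite modulusE normrX rmorphXn/= modulusE. Qed.

Lemma modulus_real t : modulus (t%:C%C : C) = `|t|.
Proof. by rewrite /modulus normc_def /= expr0n/= addr0 sqrtr_sqr. Qed.

Lemma modulus_gt0 z : z != 0 -> 0 < modulus z.
Proof.
move=> z0; rewrite lt_neqAle modulus_ge0 andbT eq_sym; apply: contra z0 => /eqP.
by move=> /modulus0_eq0 ->.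
Qed.

Lemma cvg_modulusP (T : Type) (F : set_system T) (FF : Filter F) (f : T -> C) (l : C) :
  f @ F --> l <-> (forall e : R, 0 < e -> \forall x \near F, modulus (l - f x) < e).
Proof.
split=> [/cvgrPdist_lt fl e e0|H].
  have : \forall x \near F, `|l - f x| < (e%:C%C : C) by apply: fl; rewrite ltcR.
  by apply: filterS => x; rewrite -modulusE ltcR.
apply/cvgrPdist_lt => e e0.
have [e1 e1E] : exists e1 : R, e = e1%:C%C.
  by exists (modulus e); rewrite modulusE ger0_norm// ltW.
rewrite e1E ltcR in e0; rewrite e1E.
by have := H e1 e0; apply: filterS => x; rewrite -modulusE ltcR.
Qed.

Lemma near_modulus z (e : R) : 0 < e -> \forall w \near z, modulus (z - w) < e.
Proof.
move=> e0; have zz : (fun w : C => w) @ z --> z by exact: cvg_id.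
by have /cvg_modulusP := zz; exact.
Qed.

Lemma Re_continuous : continuous (fun z : C => complex.Re z).
Proof.
move=> z; apply/(@cvgrPdist_lt _ _ _ (nbhs z)) => e e0.
near=> w; apply: (@le_lt_trans _ _ (modulus (z - w))); last by near: w; exact: near_modulus.
by rewrite (_ : _ - _ = complex.Re (z - w)) ?Re_le_modulus//; case: (z) => ? ?; case: (w).
Unshelve. all: by end_near. Qed.

Lemma Im_continuous : continuous (fun z : C => complex.Im z).
Proof.
move=> z; apply/(@cvgrPdist_lt _ _ _ (nbhs z)) => e e0.
near=> w; apply: (@le_lt_trans _ _ (modulus (z - w))); last by near: w; exact: near_modulus.
by rewrite (_ : _ - _ = complex.Im (z - w)) ?Im_le_modulus//; case: (z) => ? ?; case: (w).
Unshelve. all: by end_near. Qed.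

Lemma modulus_continuous : continuous (fun z : C => modulus z).
Proof.
move=> z; apply/(@cvgrPdist_lt _ _ _ (nbhs z)) => e e0.
near=> w; apply: (@le_lt_trans _ _ (modulus (z - w))); last by near: w; exact: near_modulus.
rewrite ler_norml.
have := modulusD (z - w) w; have := modulusD (w - z) z.
rewrite !subrK [modulus (w - z)]modulus_distC; lra.
Unshelve. all: by end_near. Qed.

(** Multiplying by a unimodular scalar reduces estimates of a modulus to
    estimates of a real part. *)
Lemma unimodular_rotation (z : C) : exists2 w : C, modulus w = 1 & w * z = (modulus z)%:C%C.
Proof.
have [->|z0] := eqVneq z 0.
  exists 1; first by rewrite /modulus normr1.
  by rewrite mul1r modulus0.
exists (`|z| / z); last by rewrite mulfVK// modulusE.
apply: (@complexI R); rewrite modulusE normrM normfV normr_id divff//.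
by rewrite normr_eq0.
Qed.

Definition cis t : C := (cos t +i* sin t)%C.

Lemma modulus_cis t : modulus (cis t) = 1.
Proof.
apply/eqP; rewrite -(@eqrXn2 _ 2)// ?modulus_ge0// expr1n modulus_sq /=.
by rewrite cos2Dsin2.
Qed.

Lemma cos_lip s t : `|cos s - cos t| <= `|s - t|.
Proof.
wlog st : s t / s <= t.
  move=> H; have [|/ltW] := leP s t; first exact: H.
  by move=> ts; rewrite -normrN opprB -[leRHS]normrN opprB; exact: H.
have [x _ xE] : exists2 x, x \in `[s, t] & cos t - cos s = - sin x * (t - s).
  apply: (@MVT_segment _ cos (fun x => - sin x)) => //.
  by apply: continuous_subspaceT => x; exact: continuous_cos.
rewrite -normrN opprB xE; rewrite normrM normrN -[leRHS]normrN opprB.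
by rewrite ler_piMl// ler_norml sin_geN1 sin_le1.
Qed.

Lemma sin_lip s t : `|sin s - sin t| <= `|s - t|.
Proof.
wlog st : s t / s <= t.
  move=> H; have [|/ltW] := leP s t; first exact: H.
  by move=> ts; rewrite -normrN opprB -[leRHS]normrN opprB; exact: H.
have [x _ xE] : exists2 x, x \in `[s, t] & sin t - sin s = cos x * (t - s).
  apply: (@MVT_segment _ sin cos) => //.
  by apply: continuous_subspaceT => x; exact: continuous_sin.
rewrite -normrN opprB xE; rewrite normrM -[leRHS]normrN opprB.
by rewrite ler_piMl// ler_norml cos_geN1 cos_le1.
Qed.

Lemma cis_lip s t : modulus (cis s - cis t) <= 2 * `|s - t|.
Proof.
rewrite (le_trans (modulus_le_ReIm _))//= mulrDl mul1r.
by rewrite lerD// ?cos_lip ?sin_lip.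
Qed.

Lemma cis_continuous : continuous cis.
Proof.
move=> t; apply/cvg_modulusP => e e0; near=> s.
rewrite (le_lt_trans (cis_lip _ _))// mulrC -ltr_pdivlMr//.
by near: s; apply: cvgr_dist_lt; rewrite ?divr_gt0//; exact: cvg_id.
Unshelve. all: by end_near. Qed.

(** First-order expansion of [cis] with an intermediate base point, the form
    needed for rectangles that merely contain the point of differentiability. *)
Lemma cis_diff s s0 t : s <= s0 <= t ->
  modulus (cis t - cis s - ('i%C : C) * cis s0 * ((t - s)%:C%C : C)) <= 2 * (t - s) ^+ 2.
Proof.
move=> /andP[ss0 s0t]; have st := le_trans ss0 s0t.
rewrite (le_trans (modulus_le_ReIm _))//=.
have [x xst xE] : exists2 x, x \in `[s, t] & cos t - cos s = - sin x * (t - s).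
  apply: (@MVT_segment _ cos (fun x => - sin x)) => //.
  by apply: continuous_subspaceT => x; exact: continuous_cos.
have [y yst yE] : exists2 y, y \in `[s, t] & sin t - sin s = cos y * (t - s).
  apply: (@MVT_segment _ sin cos) => //.
  by apply: continuous_subspaceT => y; exact: continuous_sin.
have dist (z : R) : z \in `[s, t] -> `|z - s0| <= t - s.
  by rewrite in_itv/= => /andP[? ?]; rewrite ler_norml; lra.
rewrite xE yE ?(mul0r, mul1r, mulr0, add0r, subr0, addr0).
rewrite (_ : 2 * (t - s) ^+ 2 = (t - s) * (t - s) + (t - s) * (t - s)); last ring.
apply: lerD.
  rewrite (_ : _ - _ = (sin s0 - sin x) * (t - s)); last ring.
  rewrite normrM [`|t - s|]ger0_norm ?subr_ge0//.
  by rewrite ler_wpM2r ?subr_ge0// (le_trans (sin_lip _ _))// distrC dist.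
rewrite (_ : _ - _ = (cos y - cos s0) * (t - s)); last ring.
rewrite normrM [`|t - s|]ger0_norm ?subr_ge0//.
by rewrite ler_wpM2r ?subr_ge0// (le_trans (cos_lip _ _))// dist.
Qed.

End complex_facts.

(** * The Hahn-Banach theorem *)

Section sublinear.
Context (R : realType) (V : lmodType (cplx R)).
Local Notation C := (cplx R).
Implicit Types (p q : V -> R) (x y : V).

(** Real multiples in a complex space: the real Hahn-Banach theorem is applied
    to the underlying real space without changing the carrier. *)
Definition rscale (t : R) x : V := (t%:C%C : C) *: x.

Definition sublinear q :=
  (forall x y, q (x + y) <= q x + q y) /\
  (forall t x, 0 < t -> q (rscale t x) <= t * q x).

Lemma rscaleA s t x : rscale s (rscale t x) = rscale (s * t) x.
Proof. by rewrite /rscale scalerA -(rmorphM (real_complex R)). Qed.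

Lemma rscale1 x : rscale 1 x = x.
Proof. by rewrite /rscale scale1r. Qed.

Lemma rscaleD t x y : rscale t (x + y) = rscale t x + rscale t y.
Proof. by rewrite /rscale scalerDr. Qed.

Lemma rscaleDl s t x : rscale (s + t) x = rscale s x + rscale t x.
Proof. by rewrite /rscale (rmorphD (real_complex R)) scalerDl. Qed.

Lemma rscale0 x : rscale 0 x = 0.
Proof. by rewrite /rscale scale0r. Qed.

Lemma sublinearZ q t x : sublinear q -> 0 < t -> q (rscale t x) = t * q x.
Proof.
move=> [_ qZ] t0; apply/eqP; rewrite eq_le qZ//=.
have := qZ t^-1 (rscale t x); rewrite invr_gt0 t0 => /(_ isT).
by rewrite rscaleA mulVf ?gt_eqF// rscale1 mulrC ler_pdivlMr// mulrC.
Qed.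

Lemma sublinear0 q : sublinear q -> q 0 = 0.
Proof.
move=> sq; have := sublinearZ (0 : V) sq (ltr0n R 2).
by rewrite {1}/rscale scaler0; lra.
Qed.

Lemma sublinear_opp q x : sublinear q -> - q (- x) <= q x.
Proof.
move=> sq; have := sq.1 x (- x); rewrite subrr sublinear0//; lra.
Qed.

(** The largest sublinear functional below [q] whose value at [- y] is [- q y].
    A minimal sublinear functional equals all its slides, and this forces it to
    be additive. *)
Definition slide q y x : R := inf [set q (x + rscale t y) - t * q y | t in [set t | 0 <= t]].

Lemma slide_lb q y x : sublinear q ->
  lbound [set q (x + rscale t y) - t * q y | t in [set t | 0 <= t]] (- q (- x)).
Proof.
move=> sq _ [t /= t0 <-].
have : q (rscale t y) <= q (x + rscale t y) + q (- x).
  by have := sq.1 (x + rscale t y) (- x); rewrite [x + _]addrC addrK.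
have [->|tn0] := eqVneq t 0.
  by move=> _; rewrite rscale0 addr0 mul0r subr0; exact: sublinear_opp.
rewrite sublinearZ//; [lra|by rewrite lt_neqAle eq_sym tn0].
Qed.

Lemma slide_le q y x t : sublinear q -> 0 <= t ->
  slide q y x <= q (x + rscale t y) - t * q y.
Proof.
move=> sq t0; apply: ge_inf; last by exists t.
by exists (- q (- x)); exact: slide_lb.
Qed.

Lemma slide_ge q y x c : sublinear q ->
  (forall t, 0 <= t -> c <= q (x + rscale t y) - t * q y) -> c <= slide q y x.
Proof.
move=> sq H; apply: lb_le_inf.
  by exists (q (x + rscale 0 y) - 0 * q y); exists 0 => //=.
by move=> _ [t /= t0 <-]; exact: H.
Qed.

Lemma slide_self q y x : sublinear q -> slide q y x <= q x.
Proof.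
by move=> sq; rewrite (le_trans (slide_le y x sq (lexx 0)))// rscale0 addr0 mul0r subr0.
Qed.

Lemma sublinear_slide q y : sublinear q -> sublinear (slide q y).
Proof.
move=> sq; split => [x x'|s x s0].
  rewrite -lerBlDr; apply: slide_ge => // t t0.
  rewrite lerBlDr -lerBlDl; apply: slide_ge => // t' t'0; rewrite lerBlDl.
  rewrite (le_trans (slide_le y (x + x') sq (addr_ge0 t0 t'0)))//.
  rewrite rscaleDl addrACA.
  have := sq.1 (x + rscale t y) (x' + rscale t' y); lra.
rewrite mulrC -ler_pdivrMr//; apply: slide_ge => // t t0.
rewrite ler_pdivrMr//.
rewrite (le_trans (slide_le y _ sq (mulr_ge0 (ltW s0) t0)))//.
rewrite -rscaleA -rscaleD sublinearZ//; lra.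
Qed.

(** Zorn's lemma: the infimum of a chain of sublinear functionals below [p] is
    finite, because each of them is at least [- p (- x)] at [x]. *)
Lemma sublinear_minimal_below p : sublinear p ->
  exists q, [/\ sublinear q, forall x, q x <= p x &
    forall q', sublinear q' -> (forall x, q' x <= q x) -> q' = q].
Proof.
move=> sp.
pose T := {q | sublinear q /\ forall x, q x <= p x}.
pose r (f g : T) := `[< forall x, sval g x <= sval f x >].
have p0 : sublinear p /\ forall x, p x <= p x by split.
have [||||[q [sq qp]] qmin] := @Zorn T r.
- by move=> f; apply/asboolP.
- by move=> f g h /asboolP fg /asboolP gh; apply/asboolP => x; exact: le_trans (fg x).
- move=> [f Hf] [g Hg] /asboolP/= fg /asboolP/= gf; apply/eq_exist.
  by apply/funext => x; apply/eqP; rewrite eq_le fg gf.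
- move=> A totA; have [[f0 Af0]|/set0P/negP/negPn/eqP A0] := pselect (A !=set0); last first.
    by exists (exist _ p p0) => s; rewrite A0.
  pose m x := inf [set sval f x | f in A].
  have lbA x : lbound [set sval f x | f in A] (- p (- x)).
    move=> _ [[f [sf fp]] Af <-] /=; have := sublinear_opp x sf; have := fp (- x); lra.
  have m_le f x : A f -> m x <= sval f x.
    by move=> Af; apply: ge_inf; [exists (- p (- x)); exact: lbA|exists f].
  have m_ge x c : (forall f, A f -> c <= sval f x) -> c <= m x.
    move=> H; apply: lb_le_inf; first by exists (sval f0 x); exists f0.
    by move=> _ [f Af <-]; exact: H.
  have sm : sublinear m /\ forall x, m x <= p x.
    split; last first.
      by move=> x; rewrite (le_trans (m_le f0 x Af0))//; case: (f0) => f [].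
    split => [x y|t x t0].
      rewrite -lerBlDr; apply: (m_ge) => f Af; rewrite lerBlDr -lerBlDl.
      apply: (m_ge) => g Ag; rewrite lerBlDl.
      have [/asboolP fg|/asboolP gf] := totA _ _ Af Ag.
        have [sg _] := svalP g.
        have := m_le _ (x + y) Ag; have := sg.1 x y; have := fg x; lra.
      have [sf _] := svalP f.
      have := m_le _ (x + y) Af; have := sf.1 x y; have := gf y; lra.
    rewrite mulrC -ler_pdivrMr//; apply: (m_ge) => f Af; rewrite ler_pdivrMr// mulrC.
    by have [sf _] := svalP f; exact: le_trans (m_le _ _ Af) (sf.2 _ _ t0).
  by exists (exist _ m sm) => s As; apply/asboolP => x; exact: m_le.
- exists q; split => // q' sq' q'q.
  have q'p x : q' x <= p x by exact: le_trans (q'q x) (qp x).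
  have := qmin (exist _ q' (conj sq' q'p)).
  by move=> /(_ _)/(congr1 sval)/=; apply; apply/asboolP.
Qed.

(** A minimal sublinear functional is linear. Taking it below the slide of [p]
    along [x0] fixes its value at [x0], since that slide is at most [- p x0]
    at [- x0]. *)
Theorem Hahn_Banach p x0 : sublinear p ->
  exists phi : V -> R, [/\ {morph phi : x y / x + y},
    forall t x, phi (rscale t x) = t * phi x,
    forall x, phi x <= p x & phi x0 = p x0].
Proof.
move=> sp.
have [q [sq qp qmin]] := sublinear_minimal_below (sublinear_slide x0 sp).
have qD : {morph q : x y / x + y}.
  move=> x y; apply/eqP; rewrite eq_le sq.1/=.
  have := qmin _ (sublinear_slide y sq) (fun x => slide_self y x sq).
  move=> /(congr1 (fun f => f x)) <-.
  by rewrite -lerBrDr (le_trans (slide_le y x sq ler01))// rscale1 mul1r.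
have qN x : q (- x) = - q x.
  by apply/eqP; rewrite -addr_eq0 -qD addrC subrr sublinear0.
have qZ t x : q (rscale t x) = t * q x.
  have [t0|t0|->] := ltgtP t 0; last by rewrite rscale0 sublinear0// mul0r.
    have nt0 : 0 < - t by rewrite oppr_gt0.
    apply: oppr_inj; rewrite -qN -mulNr -(sublinearZ x sq nt0).
    by congr q; rewrite /rscale (rmorphN (real_complex R)) scaleNr.
  exact: sublinearZ.
exists q; split => //.
  by move=> x; rewrite (le_trans (qp x))// slide_self.
apply/eqP; rewrite eq_le (le_trans (qp x0)) ?slide_self//=.
have := qp (- x0); rewrite qN.
have := slide_le x0 (- x0) sp (ler01 : 0 <= 1 :> R).
by rewrite rscale1 addNr sublinear0// mul1r; lra.
Qed.

End sublinear.

(** * The two-ball property of M-ideals *)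

Section dual_lemmas.
Context (R : realType) (X : normedModType (cplx R)).
Local Notation C := (cplx R).

Definition rnorm (x : X) : R := modulus `|x|.

Lemma rnormE x : (rnorm x)%:C%C = `|x|.
Proof. by rewrite /rnorm modulusE normr_id. Qed.

Lemma rnorm_le x (c : R) : (rnorm x <= c) = (`|x| <= c%:C%C).
Proof. by rewrite -rnormE lecR. Qed.

Lemma rnorm_ge0 x : 0 <= rnorm x.
Proof. exact: modulus_ge0. Qed.

Lemma rnormD x y : rnorm (x + y) <= rnorm x + rnorm y.
Proof.
by rewrite rnorm_le (rmorphD (real_complex R)) /= !rnormE; exact: ler_normD.
Qed.

Lemma rnormZ (a : C) x : rnorm (a *: x) = modulus a * rnorm x.
Proof.
by apply: (@complexI R); rewrite (rmorphM (real_complex R)) /= !rnormE modulusE normrZ.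
Qed.

Lemma contractive_is_dual (phi : X -> C) : scalar phi ->
  (forall x, modulus (phi x) <= rnorm x) -> phi \in @is_dual R X.
Proof.
move=> lphi bphi; apply/asboolP; split => // x.
have phiB y z : phi y - phi z = phi (y - z).
  by have := lphi (-1) z y; rewrite scaleN1r [- z + y]addrC => ->; rewrite mulN1r addrC.
apply/cvgrPdist_lt => e e0; near=> y.
rewrite phiB; apply: (@le_lt_trans _ _ `|x - y|).
  by rewrite -modulusE -rnormE lecR.
by near: y; exact: cvgr_dist_lt.
Unshelve. all: by end_near. Qed.

Definition dnorm (phi : dual X) : R := sup_norm (@unit_ball R X) phi.

Lemma dnormE (phi : dual X) : (dnorm phi)%:C%C = `|phi|.
Proof. by []. Qed.

Lemma dnorm_triangle (phi psi : dual X) : dnorm (phi + psi) <= dnorm phi + dnorm psi.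
Proof.
by rewrite -lecR (rmorphD (real_complex R)) /= !dnormE; exact: ler_normD.
Qed.

Lemma dnorm_ub (phi : dual X) x : rnorm x <= 1 -> modulus (phi x) <= dnorm phi.
Proof.
move=> x1; apply: sup_norm_ub; first exact: dual_bounded.
by rewrite /unit_ball /=; rewrite rnorm_le in x1.
Qed.

Lemma dnorm_le (phi : dual X) c : 0 <= c ->
  (forall x, rnorm x <= 1 -> modulus (phi x) <= c) -> dnorm phi <= c.
Proof.
move=> c0 H; apply: sup_norm_le => // x x1; apply: H.
by rewrite rnorm_le.
Qed.

End dual_lemmas.

Section complexify.
Context (R : realType) (V : lmodType (cplx R)).
Local Notation C := (cplx R).
Variable phi : V -> R.
Hypotheses (phiD : {morph phi : x y / x + y})
  (phiZ : forall t x, phi (rscale t x) = t * phi x).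

Let iC : C := 'i%C.

(** The complex-linear functional with real part [phi]. *)
Definition complexify (y : V) : C := (phi y +i* - phi (('i%C : C) *: y))%C.

Lemma complexify_scalar : scalar complexify.
Proof.
move=> a y z; rewrite /complexify.
have Za (b : C) (x : V) : b *: x = rscale (complex.Re b) x + rscale (complex.Im b) (iC *: x).
  rewrite /rscale scalerA -scalerDl; congr (_ *: _).
  by case: b => b1 b2; apply/eqP; rewrite eq_complex /=; apply/andP; split; apply/eqP; simpc; ring.
have ii (x : V) : iC *: (iC *: x) = rscale (-1) x.
  rewrite /rscale scalerA; congr (_ *: _).
  by apply/eqP; rewrite eq_complex /=; apply/andP; split; apply/eqP; simpc; ring.
rewrite -/iC scalerDr !phiD scalerA [iC * a]mulrC -scalerA (Za a y) (Za a (iC *: y)) ii !phiD !phiZ.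
case: a => a1 a2 /=.
by apply/eqP; rewrite eq_complex /=; apply/andP; split; apply/eqP; ring.
Qed.

Lemma complexify_le (q : V -> R) : (forall x, phi x <= q x) ->
  (forall (w : C) x, modulus w = 1 -> q (w *: x) = q x) ->
  forall x, modulus (complexify x) <= q x.
Proof.
move=> phiq qw x; have [w w1 wx] := unimodular_rotation (complexify x).
have : complexify (w *: x) = (modulus (complexify x))%:C%C.
  have /(_ w x 0) := complexify_scalar; rewrite addr0 wx => ->.
  have /(_ (-1) 0 0) := complexify_scalar; rewrite scaler0 addr0 => ->.
  by rewrite mulN1r addNr addr0.
by move=> /(congr1 (@complex.Re R))/= <-; rewrite -(qw w x w1).
Qed.

End complexify.

Section two_ball.
Context (R : realType) (X : normedModType (cplx R)) (J : set X).
Local Notation C := (cplx R).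
Hypothesis MJ : M_ideal J.

Let J0 : J 0. Proof. by have [[]] := MJ. Qed.

Let JD x y : J x -> J y -> J (x + y).
Proof. by have [[_ _ H] _] := MJ => Jx Jy; rewrite -[x]scale1r; exact: H. Qed.

Let JZ (a : C) x : J x -> J (a *: x).
Proof. by have [[_ _ H] _] := MJ => Jx; rewrite -[_ *: _]addr0; exact: H. Qed.

(** The distance to the diagonal of [J] in [X * X] for the maximum norm. As a
    seminorm that vanishes on the diagonal, it makes every functional that it
    dominates annihilate the diagonal. *)
Definition diag_dist (y : X * X) : R :=
  inf [set Num.max (rnorm (y.1 - e)) (rnorm (y.2 - e)) | e in J].

Lemma diag_dist_le y e : J e ->
  diag_dist y <= Num.max (rnorm (y.1 - e)) (rnorm (y.2 - e)).
Proof.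
move=> Je; apply: ge_inf; last by exists e.
by exists 0 => _ [d _ <-]; rewrite le_max rnorm_ge0.
Qed.

Lemma diag_dist_ge y c :
  (forall e, J e -> c <= Num.max (rnorm (y.1 - e)) (rnorm (y.2 - e))) ->
  c <= diag_dist y.
Proof.
move=> H; apply: lb_le_inf; last by move=> _ [e Je <-]; exact: H.
by exists (Num.max (rnorm (y.1 - 0)) (rnorm (y.2 - 0))); exists 0.
Qed.

Lemma diag_dist_adherent y c : diag_dist y < c ->
  exists2 e, J e & rnorm (y.1 - e) < c /\ rnorm (y.2 - e) < c.
Proof.
move=> yc; apply: contrapT => H; move: yc; apply/negP; rewrite -leNgt.
apply: diag_dist_ge => e Je; rewrite leNgt; apply/negP; rewrite gt_max => /andP[? ?].
by apply: H; exists e.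
Qed.

Lemma diag_distZ_le (a : C) y : a != 0 ->
  diag_dist (a *: y) <= modulus a * diag_dist y.
Proof.
move=> a0; have ma : 0 < modulus a.
  rewrite lt_neqAle modulus_ge0 andbT eq_sym; apply/negP => /eqP/modulus0_eq0 a00.
  by rewrite a00 eqxx in a0.
rewrite mulrC -ler_pdivrMr//; apply: diag_dist_ge => e Je.
rewrite ler_pdivrMr// (le_trans (diag_dist_le _ (JZ a Je)))//= -!scalerBr !rnormZ.
by rewrite -maxr_pMr ?modulus_ge0// mulrC.
Qed.

Lemma diag_dist_sublinear : sublinear diag_dist.
Proof.
split=> [y z|t y t0].
  rewrite -lerBlDr; apply: diag_dist_ge => e Je; rewrite lerBlDr -lerBlDl.
  apply: diag_dist_ge => d Jd; rewrite lerBlDl.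
  rewrite (le_trans (diag_dist_le _ (JD Je Jd)))//= ge_max; apply/andP; split.
    rewrite opprD addrACA (le_trans (rnormD _ _))//.
    by rewrite lerD// le_max lexx.
  rewrite opprD addrACA (le_trans (rnormD _ _))//.
  by rewrite lerD// le_max lexx orbT.
have {2}-> : t = modulus (t%:C%C : C).
  by apply: (@complexI R); rewrite modulusE ger0_norm// lecR ltW.
apply: diag_distZ_le; apply/eqP => /(@complexI R) t00; move: t0; by rewrite t00 ltxx.
Qed.

Lemma diag_dist_phase (w : C) y : modulus w = 1 -> diag_dist (w *: y) = diag_dist y.
Proof.
have H (v : C) z : modulus v = 1 -> diag_dist (v *: z) <= diag_dist z.
  move=> v1; rewrite -[leRHS]mul1r -v1; apply: diag_distZ_le.
  by apply/eqP => v0; move: v1; rewrite v0 modulus0 => /esym/eqP; rewrite oner_eq0.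
move=> w1; apply/eqP; rewrite eq_le H//=.
have w0 : w != 0.
  by apply/eqP => v0; move: w1; rewrite v0 modulus0 => /esym/eqP; rewrite oner_eq0.
have {1}-> : y = w^-1 *: (w *: y) by rewrite scalerA mulVf// scale1r.
apply: H; apply: (@complexI R).
by rewrite modulusE normfV -modulusE w1 invr1.
Qed.

(** The functional attaining the distance is a pair whose norms add up to at
    most [1], and the L-projection splits each of these norms into the part seen
    by [f] and the part seen by [u]. *)
Theorem M_ideal_two_ball (f u : X) (eps : R) :
  J u -> rnorm f <= 1 -> rnorm u <= 1 -> 0 < eps ->
  exists2 e, J e & rnorm (f + u - e) < 1 + eps /\ rnorm (f - u - e) < 1 + eps.
Proof.
move=> Ju f1 u1 eps0.
suff : diag_dist (f + u, f - u) <= 1.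
  by move=> H; apply: (@diag_dist_adherent (f + u, f - u)); rewrite (le_lt_trans H)// ltrDl.
have [phi [phiD phiZ phile <-]] := Hahn_Banach (f + u, f - u) diag_dist_sublinear.
pose F := complexify phi.
have F_le := complexify_le phiD phiZ phile diag_dist_phase.
have F_lin : scalar F := complexify_scalar phiD phiZ.
have F_max a b : modulus (F (a, b)) <= Num.max (rnorm a) (rnorm b).
  by rewrite (le_trans (F_le _))// (le_trans (diag_dist_le _ J0))//= !subr0.
have rnorm0 : rnorm (0 : X) = 0 by rewrite /rnorm normr0 modulus0.
have p_dual : (fun a => F (a, 0)) \in @is_dual R X.
  apply: contractive_is_dual => [a x y|x]; last first.
    by rewrite (le_trans (F_max _ _))// ge_max lexx rnorm0 rnorm_ge0.
  by rewrite -F_lin; congr F; congr pair; rewrite /= scaler0 addr0.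
have q_dual : (fun b => F (0, b)) \in @is_dual R X.
  apply: contractive_is_dual => [a x y|x]; last first.
    by rewrite (le_trans (F_max _ _))// ge_max lexx rnorm0 rnorm_ge0.
  by rewrite -F_lin; congr F; congr pair; rewrite /= scaler0 addr0.
pose p := Dual p_dual; pose q := Dual q_dual.
have Fpq a b : F (a, b) = p a + q b.
  have := F_lin 1 (a, 0) (0, b); rewrite scale1r mul1r => <-.
  by congr F; congr pair; rewrite /= ?addr0 ?add0r.
have pq1 : dnorm p + dnorm q <= 1.
  have pZ (w : C) x : p (w *: x) = w * p x.
    have [+ _] := dualP p => /(_ w x 0); rewrite addr0 => ->.
    have [+ _] := dualP p => /(_ (-1) 0 0); rewrite scaler0 addr0 => ->.
    by rewrite mulN1r addNr addr0.
  have qZ (w : C) x : q (w *: x) = w * q x.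
    have [+ _] := dualP q => /(_ w x 0); rewrite addr0 => ->.
    have [+ _] := dualP q => /(_ (-1) 0 0); rewrite scaler0 addr0 => ->.
    by rewrite mulN1r addNr addr0.
  have H a b : rnorm a <= 1 -> rnorm b <= 1 -> modulus (p a) + modulus (q b) <= 1.
    move=> a1 b1; have [w w1 wa] := unimodular_rotation (p a); have [v v1 vb] := unimodular_rotation (q b).
    have := F_max (w *: a) (v *: b).
    rewrite Fpq pZ qZ wa vb !rnormZ w1 v1 !mul1r -(rmorphD (real_complex R)) /=.
    rewrite {1}/modulus ger0_norm ?lecR ?addr_ge0 ?modulus_ge0//= => /le_trans; apply.
    by rewrite ge_max a1.
  have q_le1 : dnorm q <= 1.
    apply: dnorm_le => // b b1; have := H 0 b; rewrite rnorm0 => /(_ ler01 b1).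
    by apply: le_trans; rewrite lerDr modulus_ge0.
  rewrite -lerBrDr; apply: dnorm_le => [|a a1]; first by rewrite subr_ge0.
  rewrite lerBrDr addrC -lerBrDr; apply: dnorm_le => [|b b1].
    rewrite subr_ge0; have := H a 0 a1; rewrite rnorm0 => /(_ ler01).
    by apply: le_trans; rewrite lerDl modulus_ge0.
  by rewrite lerBrDr addrC; exact: H.
have [_ [P [_ PP ranP addP]]] := MJ.
have pqJ : annihilator J (p + q).
  move=> e Je; rewrite -[LHS]/(p e + q e) -Fpq.
  apply: modulus0_eq0; apply/eqP; rewrite eq_le modulus_ge0 andbT.
  rewrite (le_trans (F_le _))// (le_trans (diag_dist_le _ Je))//= subrr rnorm0 maxxx//.
have annP psi : annihilator J (P psi) by rewrite -ranP; exists psi.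
have Ppq : P (p + q) = p + q.
  by have : annihilator J (p + q) by []; rewrite -ranP => -[psi _ <-]; rewrite PP.
have addPr psi : dnorm (P psi) + dnorm (psi - P psi) = dnorm psi.
  by apply: (@complexI R); rewrite (rmorphD (real_complex R)) /=; exact: addP.
have Pu (psi : dual X) : psi u = (psi - P psi) u.
  by rewrite -[RHS]/(psi u - P psi u) (annP psi u Ju) subr0.
have split_val : F (f + u, f - u) = (P p + P q) f + ((p - P p) u - (q - P q) u).
  rewrite (_ : P p + P q = p + q); last by rewrite -[RHS]Ppq linearD.
  rewrite -Pu -Pu Fpq -[(p + q) f]/(p f + q f).
  have [+ _] := dualP p => /(_ 1 f u); rewrite scale1r mul1r => ->.
  have [+ _] := dualP q => /(_ (-1) u f); rewrite scaleN1r [- u + f]addrC mulN1r => ->.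
  ring.
have : phi (f + u, f - u) <= modulus (F (f + u, f - u)).
  have -> : phi (f + u, f - u) = complex.Re (F (f + u, f - u)) by [].
  rewrite -lecR modulusE; apply: le_trans (normc_ge_Re _).
  by rewrite lecR ler_norm.
move=> /le_trans; apply; apply: le_trans pq1.
rewrite split_val (le_trans (modulusD _ _))//.
have modulusB (z w : C) : modulus (z - w) <= modulus z + modulus w.
  by rewrite (le_trans (modulusD _ _))// {2}/modulus normrN.
have := modulusB ((p - P p) u) ((q - P q) u).
have := dnorm_ub (P p + P q) f1; have := dnorm_triangle (P p) (P q).
have := dnorm_ub (p - P p) u1; have := dnorm_ub (q - P q) u1.
have := addPr p; have := addPr q; lra.
Qed.

End two_ball.

(** * Goursat's theorem for closed forms on a rectangle *)

Section rectangle_bisection.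
Context (R : realType).
Variables (I : R -> R -> R -> R -> R) (a b c d : R).
Hypotheses (ab : a <= b) (cd : c <= d).

Hypothesis I_splitl : forall x y z s t, a <= x -> x <= y -> y <= z -> z <= b ->
  c <= s -> s <= t -> t <= d -> I x z s t = I x y s t + I y z s t.
Hypothesis I_splitr : forall x y s t u, a <= x -> x <= y -> y <= b ->
  c <= s -> s <= t -> t <= u -> u <= d -> I x y s u = I x y s t + I x y t u.
Hypothesis small : forall x0 s0, a <= x0 <= b -> c <= s0 <= d ->
  forall eps, 0 < eps -> exists2 delta, 0 < delta &
  forall x y s t, a <= x -> x <= x0 -> x0 <= y -> y <= b ->
    c <= s -> s <= s0 -> s0 <= t -> t <= d -> (y - x) + (t - s) < delta ->
    `|I x y s t| <= eps * ((y - x) + (t - s)) ^+ 2.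

(** Goursat's bisection: if [I a b c d] were nonzero, some quarter would keep at
    least the same proportion of the squared size, and so on for ever; the
    quarters shrink to a point that contradicts the local estimate. *)
Lemma additive_rectangle_eq0 : I a b c d = 0.
Proof.
apply/eqP; rewrite -normr_eq0 eq_le normr_ge0 andbT leNgt; apply/negP => I0.
pose L := b - a; pose W := d - c.
have L0 : 0 <= L by rewrite subr_ge0.
have W0 : 0 <= W by rewrite subr_ge0.
pose h k : R := 2^-1 ^+ k.
have h0 k : 0 < h k by rewrite exprn_gt0// invr_gt0.
have hS k : h k = h k.+1 + h k.+1 by rewrite /h exprS; lra.
have [eps eps0 Ieps] : exists2 eps, 0 < eps & eps * (L + W) ^+ 2 < `|I a b c d|.
  have D0 : 0 < (L + W) ^+ 2 + 1 by have := sqr_ge0 (L + W); lra.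
  exists (`|I a b c d| / ((L + W) ^+ 2 + 1)); first by rewrite divr_gt0.
  by rewrite mulrAC ltr_pdivrMr// ltr_pM2l//; lra.
pose bad k (p : R * R) := [/\ a <= p.1, p.1 + L * h k <= b, c <= p.2, p.2 + W * h k <= d &
  eps * ((L + W) * h k) ^+ 2 < `|I p.1 (p.1 + L * h k) p.2 (p.2 + W * h k)|].
pose sub k (p p' : R * R) := [/\ p.1 <= p'.1, p'.1 + L * h k.+1 <= p.1 + L * h k, p.2 <= p'.2 &
  p'.2 + W * h k.+1 <= p.2 + W * h k].
have step (kp : nat * (R * R)) : exists p', bad kp.1 kp.2 -> bad kp.1.+1 p' /\ sub kp.1 kp.2 p'.
  case: kp => k [x y] /=.
  have [badk|nbad] := pselect (bad k (x, y)); last by exists (x, y).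
  have [ax xb cy yd Ibig] := badk; rewrite /= in ax xb cy yd Ibig.
  set l := L * h k.+1; set w := W * h k.+1.
  have l0 : 0 <= l by rewrite mulr_ge0// ltW.
  have w0 : 0 <= w by rewrite mulr_ge0// ltW.
  have lk : L * h k = l + l by rewrite hS mulrDr.
  have wk : W * h k = w + w by rewrite hS mulrDr.
  have lwk : (L + W) * h k = (l + w) + (l + w) by rewrite mulrDl lk wk; ring.
  have lwk1 : (L + W) * h k.+1 = l + w by rewrite mulrDl.
  rewrite lk wk lwk in Ibig xb yd.
  apply: contrapT => nex.
  have good x' y' : x <= x' -> x' + l <= x + (l + l) -> y <= y' -> y' + w <= y + (w + w) ->
      `|I x' (x' + l) y' (y' + w)| <= eps * (l + w) ^+ 2.
    move=> xx' lx' yy' wy'; rewrite leNgt; apply/negP => Ib.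
    apply: nex; exists (x', y') => _; split; last by split; rewrite //= ?lk ?wk.
    split; rewrite /= -/l -/w ?lwk1//; [exact: le_trans xx'|exact: le_trans lx' _|
      exact: le_trans yy'|exact: le_trans wy' _].
  have x1 : x <= x + l by rewrite lerDl.
  have x2 : x + l <= x + (l + l) by rewrite addrA lerDl.
  have y1 : y <= y + w by rewrite lerDl.
  have y2 : y + w <= y + (w + w) by rewrite addrA lerDl.
  have xmid := le_trans ax x1; have ymid := le_trans cy y1.
  have xmid' := le_trans x2 xb; have ymid' := le_trans y2 yd.
  have g1 := good x y (lexx x) x2 (lexx y) y2.
  have g2 := good (x + l) y x1; rewrite -addrA in g2.
  have {}g2 := g2 (lexx _) (lexx y) y2.
  have g3 := good x (y + w) (lexx x) x2 y1; rewrite -addrA in g3.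
  have {}g3 := g3 (lexx _).
  have g4 := good (x + l) (y + w) x1; rewrite -!addrA in g4.
  have {}g4 := g4 (lexx _) y1 (lexx _).
  have E3 := I_splitl ax x1 x2 xb cy (le_trans y1 y2) yd.
  have E1 := I_splitr ax x1 xmid' cy y1 y2 yd.
  have E2 := I_splitr xmid x2 xb cy y1 y2 yd.
  move: Ibig; rewrite E3 E2 E1.
  have -> : eps * ((l + w) + (l + w)) ^+ 2 = 4 * (eps * (l + w) ^+ 2) by ring.
  have := ler_normD (I x (x + l) y (y + w) + I x (x + l) (y + w) (y + (w + w)))
    (I (x + l) (x + (l + l)) y (y + w) + I (x + l) (x + (l + l)) (y + w) (y + (w + w))).
  have := ler_normD (I x (x + l) y (y + w)) (I x (x + l) (y + w) (y + (w + w))).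
  have := ler_normD (I (x + l) (x + (l + l)) y (y + w)) (I (x + l) (x + (l + l)) (y + w) (y + (w + w))).
  move: g1 g2 g3 g4; set G := eps * _.
  clear; lra.
have [g gP] := choice step.
pose s := fix s k := if k is k'.+1 then g (k', s k') else (a, c).
have sbad k : bad k (s k).
  elim: k => [|k IH]; last by have [] := gP (k, s k) IH.
  rewrite /bad /= /h !mulr1 /L /W; split; try lra.
  by rewrite !subrKC.
have ssub k : sub k (s k) (s k.+1) by have [] := gP (k, s k) (sbad k).
have nested j k : (s j).1 <= (s (j + k)%N).1 /\ (s (j + k)%N).1 + L * h (j + k)%N <= (s j).1 + L * h j /\
  (s j).2 <= (s (j + k)%N).2 /\ (s (j + k)%N).2 + W * h (j + k)%N <= (s j).2 + W * h j.
  elim: k => [|k [i1 [i2 [i3 i4]]]]; first by rewrite addn0 !lexx.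
  by have [] := ssub (j + k)%N; rewrite addnS; lra.
have Lh k : 0 <= L * h k by rewrite mulr_ge0// ltW.
have Wh k : 0 <= W * h k by rewrite mulr_ge0// ltW.
have mono j k : (s k).1 <= (s j).1 + L * h j /\ (s k).2 <= (s j).2 + W * h j.
  have [jk|kj] := leqP j k.
    have := nested j (k - j)%N; rewrite subnKC//.
    have := Lh k; have := Wh k; lra.
  have := nested k (j - k)%N; rewrite subnKC ?(ltnW kj)//.
  have := Lh j; have := Wh j; lra.
(* The common point of the nested rectangles. *)
pose x0 := sup (range (fun k => (s k).1)); pose y0 := sup (range (fun k => (s k).2)).
have x0P k : (s k).1 <= x0 <= (s k).1 + L * h k.
  apply/andP; split.
    apply: ub_le_sup; last by exists k.
    by exists ((s 0%N).1 + L * h 0%N) => _ [j _ <-]; have [] := mono 0%N j.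
  apply: ge_sup; first by exists (s 0%N).1; exists 0%N.
  by move=> _ [j _ <-]; have [] := mono k j.
have y0P k : (s k).2 <= y0 <= (s k).2 + W * h k.
  apply/andP; split.
    apply: ub_le_sup; last by exists k.
    by exists ((s 0%N).2 + W * h 0%N) => _ [j _ <-]; have [] := mono 0%N j.
  apply: ge_sup; first by exists (s 0%N).2; exists 0%N.
  by move=> _ [j _ <-]; have [] := mono k j.
have [delta d0 Hd] : exists2 delta, 0 < delta &
  forall x y s t, a <= x -> x <= x0 -> x0 <= y -> y <= b ->
    c <= s -> s <= y0 -> y0 <= t -> t <= d -> (y - x) + (t - s) < delta ->
    `|I x y s t| <= eps * ((y - x) + (t - s)) ^+ 2.
  apply: small => //.
    by have := x0P 0%N; rewrite /= /h mulr1 /L; lra.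
  by have := y0P 0%N; rewrite /= /h mulr1 /W; lra.
have [k hk] : exists k, (L + W) * h k < delta.
  have D0 : 0 < delta / (L + W + 1) by rewrite divr_gt0//; lra.
  have [N _ /(_ N (leqnn N)) /= NP] := near_infty_natSinv_expn_lt (PosNum D0).
  exists N; move: NP; rewrite ltr_pdivlMr; last by lra.
  rewrite /h exprVn div1r; apply: le_lt_trans.
  by rewrite mulrC ler_wpM2l ?invr_ge0 ?exprn_ge0//; lra.
have [k1 k2 k3 k4 k5] := sbad k.
have := x0P k; have := y0P k.
have := Hd (s k).1 ((s k).1 + L * h k) (s k).2 ((s k).2 + W * h k) k1 _ _ k2 k3 _ _ k4.
have E x y : x + y - x = y :> R by ring.
rewrite !E -mulrDl => H /andP[y1 y2] /andP[x1 x2].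
by have := H x1 x2 y1 y2 hk; rewrite leNgt k5.
Qed.

End rectangle_bisection.

Section segment_integral.
Context (R : realType).
Local Notation mu := (@lebesgue_measure R).
Implicit Types (f g : R -> R) (a b c e : R).

Definition segint a b f : R := \int[mu]_(x in `[a, b]) f x.

Lemma segment_integrable a b f : {within `[a, b], continuous f} ->
  mu.-integrable `[a, b] (EFin \o f).
Proof. by apply: continuous_compact_integrable; exact: segment_compact. Qed.

Lemma within_segmentS a b a' b' f : a <= a' -> b' <= b ->
  {within `[a, b], continuous f} -> {within `[a', b'], continuous f}.
Proof.
move=> aa' bb'; apply: continuous_subspaceW => x /=.
by rewrite !in_itv/= => /andP[? ?]; rewrite (le_trans aa')//= (le_trans _ bb').
Qed.

Lemma segint_split a b c f : a <= b -> b <= c -> {within `[a, c], continuous f} ->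
  segint a c f = segint a b f + segint b c f.
Proof.
move=> ab bc cf.
have := @Rintegral_itvB R f (BLeft a) (BRight c) b (segment_integrable cf).
rewrite !bnd_simp => /(_ ab bc); rewrite /segint => /eqP.
rewrite subr_eq addrC => /eqP ->; congr (_ + _).
apply: Rintegral_itv_obnd_cbnd.
apply: integrableS (segment_integrable cf) => //; apply: subset_itv; rewrite bnd_simp//.
Qed.

Lemma segintB a b f g : {within `[a, b], continuous f} ->
  {within `[a, b], continuous g} ->
  segint a b (fun x => f x - g x) = segint a b f - segint a b g.
Proof. by move=> cf cg; rewrite /segint RintegralB//; exact: segment_integrable. Qed.

Lemma segint_cst a b c : a <= b -> segint a b (cst c) = c * (b - a).
Proof.
move=> ab; rewrite /segint Rintegral_cst//; congr (_ * _).
apply: etrans (congr1 fine (lebesgue_measure_itv `[a, b])) _.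
rewrite /= lte_fin; case: ltP => // ba.
by rewrite (@le_anti _ _ a b) ?subrr// ab ba.
Qed.

Lemma segint_le a b f g : {within `[a, b], continuous f} ->
  {within `[a, b], continuous g} ->
  (forall x, a <= x <= b -> f x <= g x) -> segint a b f <= segint a b g.
Proof.
move=> cf cg fg; apply: le_Rintegral => //; exact: segment_integrable.
Qed.

Lemma segint_approx a b c e f : a <= b -> {within `[a, b], continuous f} ->
  (forall x, a <= x <= b -> `|f x - c| <= e) ->
  `|segint a b f - c * (b - a)| <= e * (b - a).
Proof.
move=> ab cf H.
have ccst k : {within `[a, b], continuous (cst k : R -> R)}.
  by apply: continuous_subspaceT => x; exact: cvg_cst.
have := @segint_le a b f (cst (c + e)) cf (ccst _).
have := @segint_le a b (cst (c - e)) f (ccst _) cf.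
rewrite !segint_cst// => H1 H2; rewrite ler_norml.
apply/andP; split.
  have {}H1 := H1 _; have : (c - e) * (b - a) <= segint a b f.
    by apply: H1 => x /H; rewrite ler_norml /=; lra.
  lra.
have : segint a b f <= (c + e) * (b - a).
  by apply: H2 => x /H; rewrite ler_norml /=; lra.
lra.
Qed.

End segment_integral.

Section closed_form.
Context (R : realType).
Variables (A B : R -> R -> R) (a b c d : R).
Hypotheses (ab : a <= b) (cd : c <= d).
Hypothesis contA : forall s, c <= s <= d -> {within `[a, b], continuous (A^~ s)}.
Hypothesis contB : forall x, a <= x <= b -> {within `[c, d], continuous (B x)}.
Hypothesis closedAB : forall x0 s0, a <= x0 <= b -> c <= s0 <= d ->
  exists k : R, forall eps, 0 < eps -> exists2 delta, 0 < delta &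
  forall x y s t, a <= x -> x <= x0 -> x0 <= y -> y <= b ->
    c <= s -> s <= s0 -> s0 <= t -> t <= d -> (y - x) + (t - s) < delta ->
    (forall s', s <= s' <= t -> `|B y s' - B x s' - k * (y - x)| <= eps * ((y - x) + (t - s))) /\
    (forall x', x <= x' <= y -> `|A x' t - A x' s - k * (t - s)| <= eps * ((y - x) + (t - s))).

(** Goursat's theorem for the form [A dx + B ds]. The hypothesis says that
    [dA/ds] and [dB/dx] exist and agree at each point, in the slightly uniform
    sense provided by Frechet differentiability; no continuity of these
    derivatives is available. *)
Theorem closed_form_rectangle :
  segint c d (B b) - segint c d (B a) = segint a b (A^~ d) - segint a b (A^~ c).
Proof.
apply/eqP; rewrite -subr_eq0; apply/eqP.
apply: (@additive_rectangle_eq0 R (fun x y s t =>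
  segint s t (B y) - segint s t (B x) - (segint x y (A^~ t) - segint x y (A^~ s)))) => //.
- move=> x y z s t ax xy yz zb cs st td.
  rewrite !(@segint_split _ x y z)//; first ring.
    by apply: within_segmentS (contA _) => //; lra.
  by apply: within_segmentS (contA _) => //; lra.
- move=> x y s t u ax xy yb cs st tu ud.
  rewrite !(@segint_split _ s t u)//; first ring.
    by apply: within_segmentS (contB _) => //; lra.
  by apply: within_segmentS (contB _) => //; lra.
move=> x0 s0 x0ab s0cd eps eps0.
have [k kP] := closedAB x0ab s0cd.
have [delta d0 H] := kP _ eps0.
exists delta => // x y s t ax xx0 x0y yb cs ss0 s0t td dlt.
have [HB HA] := H x y s t ax xx0 x0y yb cs ss0 s0t td dlt.
have cB z : a <= z <= b -> {within `[s, t], continuous (B z)}.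
  by move=> zab; apply: within_segmentS (contB zab); lra.
have cA z : c <= z <= d -> {within `[x, y], continuous (A^~ z)}.
  by move=> zab; apply: within_segmentS (contA zab); lra.
have wB (S : set R) (f g : R -> R) : {within S, continuous f} ->
    {within S, continuous g} -> {within S, continuous (fun x => f x - g x)}.
  by move=> cf cg z; apply: continuousB; [exact: cf|exact: cg].
have xab : a <= x <= b by rewrite ax (le_trans (le_trans xx0 x0y)).
have yab : a <= y <= b by rewrite yb (le_trans ax (le_trans xx0 x0y)).
have scd : c <= s <= d by rewrite cs (le_trans (le_trans ss0 s0t)).
have tcd : c <= t <= d by rewrite td (le_trans cs (le_trans ss0 s0t)).
rewrite -(segintB (cB _ yab) (cB _ xab)) -(segintB (cA _ tcd) (cA _ scd)).
set w := y - x + (t - s) in HA HB *.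
have st := le_trans ss0 s0t; have xy := le_trans xx0 x0y.
have := segint_approx st (wB _ _ _ (cB y yab) (cB x xab)) HB.
have := segint_approx xy (wB _ _ _ (cA t tcd) (cA s scd)) HA.
move=> IA IB; move: IA IB; set PA := segint _ _ _; set PB := segint _ _ _ => IA IB.
have -> : PB - PA = (PB - k * (y - x) * (t - s)) - (PA - k * (t - s) * (y - x)) by ring.
rewrite (le_trans (ler_normB _ _))// (le_trans (lerD IB IA))//.
by rewrite -mulrDr [_ - s + _]addrC -mulrA -expr2.
Qed.

End closed_form.

(** * A Cauchy estimate on a circle *)

Section complex_differentiability.
Context (R : realType).
Local Notation C := (cplx R).
Implicit Types (h g : C -> C) (w D : C).

(** Complex differentiability with derivative [D], in terms of real bounds. *)
Definition cdiff h w D := forall e : R, 0 < e -> exists2 d, 0 < d &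
  forall w', modulus (w' - w) < d -> modulus (h w' - h w - D * (w' - w)) <= e * modulus (w' - w).

Lemma cdiff_continuous h w D : cdiff h w D -> {for w, continuous h}.
Proof.
move=> hD; apply/(@cvg_modulusP _ _ (nbhs w)) => e e0.
have [d d0 H] := hD 1 ltr01.
have m0 : 0 < modulus D + 1 + 1 by have := modulus_ge0 D; lra.
near=> w'.
have wd : modulus (w - w') < d by near: w'; exact: near_modulus.
have we : modulus (w - w') < e / (modulus D + 1 + 1).
  by near: w'; apply: near_modulus; rewrite divr_gt0.
rewrite modulus_distC in wd; rewrite modulus_distC in we.
rewrite modulus_distC; have := H _ wd; move: we; rewrite ltr_pdivlMr//.
set E := _ - D * _ => we HE.
have -> : h w' - h w = E + D * (w' - w) by rewrite /E; ring.
apply: le_lt_trans (modulusD _ _) _; rewrite modulusM.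
by have := modulus_ge0 (w' - w); lra.
Unshelve. all: by end_near. Qed.

End complex_differentiability.

Section cauchy_bound.
Context (R : realType).
Local Notation C := (cplx R).
Variables (h : C -> C) (a : C) (r : R).
Hypotheses (hol : forall w, modulus w < 1 -> exists D, cdiff h w D)
  (ar : modulus a < r) (r1 : r < 1).

Let r0 : 0 < r. Proof. exact: le_lt_trans (modulus_ge0 a) ar. Qed.
Let a0 : 0 <= modulus a. Proof. exact: modulus_ge0. Qed.

Let rC : C := r%:C%C.
Let P t : C := rC * cis t - a.
(* [H x] contracts the circle of radius [r] to [a] as [x] goes from [1] to [0].
   Pulled back by [H], the Cauchy kernel [dw / (w - a)] becomes
   [dx / x + 'i * kappa t * dt], whose angular part is free of [x]. *)
Let H (x t : R) : C := a + (x%:C%C : C) * P t.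
Let kappa t : C := rC * cis t / P t.
Let K : R := (r - modulus a)^-1.

Let K0 : 0 < K. Proof. by rewrite invr_gt0 subr_gt0. Qed.

Let modulus_rcis t : modulus (rC * cis t) = r.
Proof. by rewrite modulusM modulus_cis mulr1 modulus_real gtr0_norm. Qed.

Let modulusP_ge t : r - modulus a <= modulus (P t).
Proof.
have := modulusD (P t) a; rewrite /P subrK modulus_rcis; lra.
Qed.

Let modulusP_le t : modulus (P t) <= 2.
Proof. by have := modulusB (rC * cis t) a; rewrite modulus_rcis -/(P t); have har := ar; have hr1 := r1; lra. Qed.

Let P_neq0 t : P t != 0.
Proof.
apply/eqP => Pt; have := modulusP_ge t; rewrite Pt modulus0; have har := ar; lra.
Qed.

Let modulus_kappa t : modulus (kappa t) <= K.
Proof.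
rewrite /kappa modulusM modulus_rcis modulusV.
rewrite (@le_trans _ _ (modulus (P t))^-1)//.
  rewrite ler_piMl ?invr_ge0 ?modulus_ge0//; exact: ltW.
by rewrite /K lef_pV2 ?posrE ?modulusP_ge ?subr_gt0// modulus_gt0.
Qed.

Let H_disc (x t : R) : 0 <= x <= 1 -> modulus (H x t) < 1.
Proof.
move=> /andP[x0 x1].
have -> : H x t = ((1 - x)%:C%C : C) * a + (x%:C%C : C) * (rC * cis t).
  by rewrite /H /P (rmorphB (real_complex R)) /=; ring.
rewrite (le_lt_trans (modulusD _ _))// (modulusM _ a) (modulusM _ (rC * cis t)).
rewrite modulus_rcis !modulus_real.
rewrite !ger0_norm//; last by rewrite subr_ge0.
have : (1 - x) * modulus a <= (1 - x) * r by rewrite ler_wpM2l ?subr_ge0// ltW.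
have hr1 := r1; lra.
Qed.

Lemma Re_kernel_ge (z b : C) : modulus b < modulus z -> 2^-1 <= complex.Re (z / (z - b)).
Proof.
move=> bz; have zb : z - b != 0.
  by apply: contraTneq bz => /subr0_eq ->; rewrite ltxx.
have := modulus_gt0 zb; rewrite -(@ltr_pXn2r _ 2)// ?nnegrE ?modulus_ge0//.
rewrite expr0n/= => N0.
have : modulus b ^+ 2 < modulus z ^+ 2 by rewrite ltr_pXn2r// nnegrE modulus_ge0.
move: N0; rewrite !modulus_sq.
case: z b {bz zb} => [x y] [u v] /=; set N := (_ ^+ 2 + _ ^+ 2).
move=> N0; have -> : x ^+ 2 + y ^+ 2 = N + 2 * (x * u + y * v) - u ^+ 2 - v ^+ 2 by rewrite /N; ring.
move=> H1.
rewrite (_ : _ - _ = (x * (x - u) + y * (y - v)) / N); last by rewrite /N; ring.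
rewrite ler_pdivlMr//; rewrite /N in H1 *; lra.
Qed.

Let Re_kappa t : 2^-1 <= complex.Re (kappa t).
Proof. by apply: Re_kernel_ge; rewrite modulus_rcis. Qed.

Let H_lip (x t x0 t0 : R) : 0 <= x0 <= 1 ->
  modulus (H x t - H x0 t0) <= 2 * (`|x - x0| + `|t - t0|).
Proof.
move=> /andP[x00 x01].
have -> : H x t - H x0 t0 = ((x - x0)%:C%C : C) * P t + ((x0 * r)%:C%C : C) * (cis t - cis t0).
  by rewrite /H /P (rmorphB (real_complex R)) (rmorphM (real_complex R)) /= -/rC; ring.
rewrite (le_trans (modulusD _ _))// !modulusM !modulus_real mulrDr lerD//.
  by rewrite mulrC ler_wpM2r.
rewrite ger0_norm ?mulr_ge0 ?(ltW r0)//.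
rewrite (le_trans _ (cis_lip t t0))// ler_piMl ?modulus_ge0//.
by rewrite mulr_ile1// ltW.
Qed.

Variable w : C.
Hypotheses (w1 : modulus w = 1) (wha : w * h a = (modulus (h a))%:C%C).

(* The real form [A dx + B dt] is the pull-back by [H] of the real part of
   [- 'i * w * h z / (z - a) dz]; the scalar [w] makes the value at [a] real
   and nonnegative. *)
Let B x t : R := complex.Re (w * (h (H x t) * kappa t)).
Let A x t : R := complex.Im (w * h (H x t)) / x.

Let P_continuous : continuous P.
Proof.
move=> t; apply: cvgB; last exact: cvg_cst.
by apply: cvgM; [exact: cvg_cst|exact: cis_continuous].
Qed.

Let kappa_continuous : continuous kappa.
Proof.
move=> t; apply: cvgM.
  by apply: cvgM; [exact: cvg_cst|exact: cis_continuous].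
by apply: cvgV; [exact: P_neq0|exact: P_continuous].
Qed.

Let h_continuous z : modulus z < 1 -> {for z, continuous h}.
Proof. by move=> /hol[D /cdiff_continuous]. Qed.

Let B_continuous (x : R) : 0 <= x <= 1 -> continuous (B x).
Proof.
move=> x01 t; apply: (@continuous_comp _ _ _ (fun t => w * (h (H x t) * kappa t)) (fun z : C => complex.Re z)); last exact: Re_continuous.
apply: cvgM; first exact: cvg_cst.
apply: cvgM; last exact: kappa_continuous.
apply: (@continuous_comp _ _ _ (H x) h); last by apply: h_continuous; exact: H_disc.
apply: cvgD; first exact: cvg_cst.
by apply: cvgM; [exact: cvg_cst|exact: P_continuous].
Qed.

Let A_continuous (t x : R) : 0 < x <= 1 -> {for x, continuous (A^~ t)}.
Proof.
move=> /andP[x0 x1]; apply: cvgM; last first.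
  by apply: cvgV; [rewrite gt_eqF|exact: cvg_id].
apply: (@continuous_comp _ _ _ (fun x => w * h (H x t)) (fun z : C => complex.Im z)); last exact: Im_continuous.
apply: cvgM; first exact: cvg_cst.
apply: (@continuous_comp _ _ _ (H^~ t) h); last by apply: h_continuous; apply: H_disc; rewrite x1 ltW.
apply: cvgD; first exact: cvg_cst.
apply: cvgM; last exact: cvg_cst.
apply/cvg_modulusP => e e0; near=> y.
rewrite -(rmorphB (real_complex R)) modulus_real.
by near: y; apply: cvgr_dist_lt => //; exact: cvg_id.
Unshelve. all: by end_near. Qed.


Let ReB (z z' : C) : complex.Re (z - z') = complex.Re z - complex.Re z'.
Proof. by case: z; case: z'. Qed.
Let ImB (z z' : C) : complex.Im (z - z') = complex.Im z - complex.Im z'.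
Proof. by case: z; case: z'. Qed.
Let ReM (z : C) (t : R) : complex.Re (z * (t%:C%C : C)) = complex.Re z * t.
Proof. by case: z => x y /=; rewrite mulr0 subr0. Qed.
Let ImM (z : C) (t : R) : complex.Im (z * (t%:C%C : C)) = complex.Im z * t.
Proof. by case: z => x y /=; rewrite mulr0 add0r. Qed.
Let ImiM (z : C) : complex.Im (('i%C : C) * z) = complex.Re z.
Proof. by case: z => x y /=; rewrite mul0r mul1r add0r. Qed.

(** [D] being the derivative of [h] at [H x0 s0], both [dA/dt] and [dB/dx] equal
    [Re (w * D * r * cis s0)]. *)
Let AB_closed (al x0 s0 : R) : 0 < al -> al <= x0 <= 1 ->
  exists k : R, forall eps : R, 0 < eps -> exists2 delta : R, 0 < delta &
  forall x y s t : R, al <= x -> x <= x0 -> x0 <= y -> y <= 1 -> s <= s0 -> s0 <= t ->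
    (y - x) + (t - s) < delta ->
    (forall s' : R, s <= s' <= t -> `|B y s' - B x s' - k * (y - x)| <= eps * ((y - x) + (t - s))) /\
    (forall x' : R, x <= x' <= y -> `|A x' t - A x' s - k * (t - s)| <= eps * ((y - x) + (t - s))).
Proof.
move=> al0 /andP[alx0 x01].
have x00 : 0 <= x0 <= 1 by rewrite x01 (le_trans (ltW al0)).
have [D hD] := hol (H_disc s0 x00).
exists (complex.Re (w * D * rC * cis s0)) => eps eps0.
(* [M] bounds both [|kappa|] in [B] and the factor [1 / x] in [A]. *)
pose M := K + al^-1.
have M0 : 0 < M by rewrite addr_gt0// invr_gt0.
pose eta := eps / (8 * M).
have eta0 : 0 < eta by rewrite divr_gt0// mulr_gt0.
have etaM : eta * M = eps / 8.
  by rewrite /eta; field; rewrite gt_eqF.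
have [d1 d10 Hd1] := hD _ eta0.
have mD0 := modulus_ge0 D.
pose d2 := eps / (4 * modulus D + 1).
have d20 : 0 < d2 by rewrite divr_gt0//; lra.
have d2E : d2 * (4 * modulus D + 1) = eps.
  by rewrite /d2 mulfVK// gt_eqF//; lra.
exists (Num.min (d1 / 2) d2); first by rewrite lt_min d20 andbT divr_gt0.
move=> x y s t alx xx0 x0y y1 ss0 s0t; set d := _ + _; rewrite lt_min => /andP[dd1 dd2].
have d0 : 0 <= d by rewrite /d; lra.
have Dd : 2 * modulus D * d <= eps / 2.
  have : d * (4 * modulus D + 1) <= eps by rewrite -d2E ler_wpM2r ?ltW//; lra.
  have : 0 <= d * modulus D by rewrite mulr_ge0.
  lra.
have expand x' t' : x <= x' <= y -> s <= t' <= t ->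
    modulus (h (H x' t') - h (H x0 s0) - D * (H x' t' - H x0 s0)) <= eta * (2 * d).
  move=> /andP[xx' x'y] /andP[st' t't].
  have dist : modulus (H x' t' - H x0 s0) <= 2 * d.
    rewrite (le_trans (H_lip _ _ _ x00))// ler_wpM2l// /d.
    by apply: lerD; rewrite ler_norml; lra.
  rewrite (le_trans (Hd1 _ _))//; first by rewrite (le_lt_trans dist)//; lra.
  by rewrite ler_wpM2l// ltW.
have expand2 x1 t1 x2 t2 : x <= x1 <= y -> s <= t1 <= t -> x <= x2 <= y -> s <= t2 <= t ->
    modulus (h (H x1 t1) - h (H x2 t2) - D * (H x1 t1 - H x2 t2)) <= eta * (4 * d).
  move=> p1 p2 p3 p4; have e1 := expand _ _ p1 p2; have e2 := expand _ _ p3 p4.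
  have := modulusB (h (H x1 t1) - h (H x0 s0) - D * (H x1 t1 - H x0 s0))
    (h (H x2 t2) - h (H x0 s0) - D * (H x2 t2 - H x0 s0)).
  rewrite [X in modulus X <= _ -> _](_ : _ =
    h (H x1 t1) - h (H x2 t2) - D * (H x1 t1 - H x2 t2)); last by ring.
  lra.
have xx : x <= x <= y by rewrite lexx (le_trans xx0).
have yy : x <= y <= y by rewrite lexx (le_trans xx0).
have ss : s <= s <= t by rewrite lexx (le_trans ss0).
have tt : s <= t <= t by rewrite lexx (le_trans ss0).
have yxd : y - x <= d by rewrite /d; lra.
have tsd : t - s <= d by rewrite /d; lra.
have yx0 : 0 <= y - x by lra.
have ts0 : 0 <= t - s by lra.
split=> [s' ss't|x' xx'y].
  have E := expand2 _ _ _ _ yy ss't xx ss't.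
  rewrite /B -ReB -ReM -ReB (le_trans (Re_le_modulus _))//.
  set g1 := h (H y s') in E *; set g2 := h (H x s') in E *.
  have -> : w * (g1 * kappa s') - w * (g2 * kappa s') - w * D * rC * cis s0 * ((y - x)%:C%C : C)
     = w * kappa s' * (g1 - g2 - D * (H y s' - H x s')) +
       w * D * ((y - x)%:C%C : C) * rC * (cis s' - cis s0).
    have kP : kappa s' * P s' - rC * cis s' = 0 by rewrite /kappa mulfVK// subrr.
    transitivity (w * (g1 * kappa s') - w * (g2 * kappa s') - w * D * rC * cis s0 * ((y - x)%:C%C : C)
      - w * D * ((y - x)%:C%C : C) * (kappa s' * P s' - rC * cis s')).
      by rewrite kP mulr0 subr0.
    by rewrite (rmorphB (real_complex R)) /= /H; ring.
  rewrite (le_trans (modulusD _ _))// (modulusM (w * _)) (modulusM w (kappa s')).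
  rewrite (modulusM _ (cis s' - cis s0)) (modulusM _ rC) (modulusM _ ((y - x)%:C%C)) (modulusM w D).
  rewrite w1 !mul1r !modulus_real (ger0_norm yx0) (gtr0_norm r0).
  have T1 : modulus (kappa s') * modulus (g1 - g2 - D * (H y s' - H x s')) <= eps / 2 * d.
    apply: (@le_trans _ _ (M * (eta * (4 * d)))).
      rewrite ler_pM ?modulus_ge0//.
      by rewrite (le_trans (modulus_kappa _))// lerDl invr_ge0 ltW.
    by rewrite mulrA [M * _]mulrC etaM; lra.
  have T2 : modulus D * (y - x) * r * modulus (cis s' - cis s0) <= eps / 2 * d.
    apply: (@le_trans _ _ (modulus D * (2 * d) * d)); last first.
      by rewrite mulrA [_ * 2]mulrC ler_wpM2r.
    have c2 : modulus (cis s' - cis s0) <= 2 * d.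
      rewrite (le_trans (cis_lip _ _))// ler_wpM2l// ler_norml.
      by move: ss't => /andP[? ?]; lra.
    have -> : modulus D * (y - x) * r * modulus (cis s' - cis s0) =
      modulus D * (r * modulus (cis s' - cis s0)) * (y - x) by ring.
    apply: ler_pM => //; first by rewrite !mulr_ge0// ?modulus_ge0// ltW.
    rewrite ler_wpM2l// (le_trans _ c2)// ler_piMl ?modulus_ge0//; exact: ltW.
  lra.
have E := expand2 _ _ _ _ xx'y tt xx'y ss.
have x'al : al <= x' by case/andP: xx'y => ? _; exact: le_trans alx _.
have x'0 : 0 < x' by exact: lt_le_trans x'al.
rewrite /A -mulrBl -ImB -[x'^-1]/(x'^-1) -ImM -ImiM -ImM -ImB (le_trans (Im_le_modulus _))//.
set g1 := h (H x' t) in E *; set g2 := h (H x' s) in E *.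
set iR : C := (x'^-1)%:C%C.
have iRx : iR * (x'%:C%C : C) = 1.
  by rewrite /iR -(rmorphM (real_complex R)) /= mulVf// gt_eqF.
have -> : (w * g1 - w * g2) * iR - ('i%C : C) * (w * D * rC * cis s0) * ((t - s)%:C%C : C)
  = w * iR * (g1 - g2 - D * (H x' t - H x' s)) +
    w * D * rC * (cis t - cis s - ('i%C : C) * cis s0 * ((t - s)%:C%C : C)).
  transitivity (w * iR * (g1 - g2 - D * (H x' t - H x' s)) +
    w * D * rC * (iR * (x'%:C%C : C) * (cis t - cis s) - ('i%C : C) * cis s0 * ((t - s)%:C%C : C))).
    by rewrite /H /P; ring.
  by rewrite iRx mul1r.
rewrite (le_trans (modulusD _ _))// !modulusM w1 !mul1r !modulus_real.
rewrite (gtr0_norm r0).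
have T1 : `|x'^-1| * modulus (g1 - g2 - D * (H x' t - H x' s)) <= eps / 2 * d.
  apply: (@le_trans _ _ (M * (eta * (4 * d)))).
    rewrite ler_pM ?modulus_ge0//.
    rewrite gtr0_norm ?invr_gt0// (@le_trans _ _ al^-1)//; last by rewrite lerDr ltW.
    by rewrite lef_pV2.
  by rewrite mulrA [M * _]mulrC etaM; lra.
have T2 : modulus D * r * modulus (cis t - cis s - ('i%C : C) * cis s0 * ((t - s)%:C%C : C)) <= eps / 2 * d.
  apply: (@le_trans _ _ (modulus D * (2 * d) * d)); last first.
    by rewrite mulrA [_ * 2]mulrC ler_wpM2r.
  rewrite -(mulrA (modulus D) r) -(mulrA (modulus D) (2 * d)) ler_wpM2l//.
  rewrite (@le_trans _ _ (2 * (t - s) ^+ 2))//; last first.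
    by rewrite -(mulrA 2 d) ler_wpM2l// -expr2 lerXn2r// nnegrE.
  have st0 : s <= s0 <= t by rewrite ss0 s0t.
  rewrite (le_trans _ (cis_diff st0))//.
  by rewrite ler_piMl ?modulus_ge0// ltW.
lra.
Qed.


Let cis2pi : cis (2 * pi) = cis 0 :> C.
Proof. by rewrite /cis mulr_natl cos2pi sin2pi cos0 sin0. Qed.

Let two_pi_ge0 : 0 <= 2 * pi :> R. Proof. by rewrite ltW// two_pi_gt0. Qed.

(** The circle integral is unchanged under the contraction: the two sides of
    the rectangle cancel because the angle is [2 * pi]-periodic. *)
Let segint_B (al : R) : 0 < al -> al <= 1 ->
  segint 0 (2 * pi) (B 1) = segint 0 (2 * pi) (B al).
Proof.
move=> al0 al1; apply/eqP; rewrite -subr_eq0; apply/eqP.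
rewrite (@closed_form_rectangle R A B al 1 0 (2 * pi) al1 two_pi_ge0).
- rewrite (_ : (A^~ (2 * pi)) = (A^~ 0)) ?subrr//.
  by apply/funext => x; rewrite /A /H /P cis2pi.
- move=> s _; apply: continuous_in_subspaceT => x; rewrite inE/= in_itv/= => /andP[alx x1].
  by apply: A_continuous; rewrite x1 (lt_le_trans al0).
- move=> x /andP[alx x1]; apply: continuous_subspaceT; apply: B_continuous.
  by rewrite x1 (le_trans (ltW al0)).
move=> x0 s0 x0al _; have [k kP] := AB_closed s0 al0 x0al.
exists k => eps /kP[d d0 dP]; exists d => // x y s t ? ? ? ? _ ? ? _.
exact: dP.
Qed.

Let circle_mean : R := segint 0 (2 * pi) (fun t => modulus (h (rC * cis t))).

(** On a small circle around [a] the integrand is close to [|h a| * kappa],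
    whose real part is at least [|h a| / 2]. This lower bound replaces the
    evaluation of the integral of [kappa]. *)
Let near_center : h a != 0 -> exists2 al : R, 0 < al <= 1 &
  forall t, modulus (h a) / 4 <= B al t.
Proof.
move=> ha0; have c0 := modulus_gt0 ha0; set c := modulus (h a) in c0 *.
have ha1 : modulus a < 1 by exact: lt_trans ar r1.
have [D hD] := hol ha1.
have mD := modulus_ge0 D.
have [d d0 Hd] := hD 1 ltr01.
have D1 : 0 < modulus D + 1 by rewrite ltr_wpDl.
have q0 : 0 < c / (4 * K) / (2 * (modulus D + 1)).
  by apply: divr_gt0; [apply: divr_gt0 => //; exact: mulr_gt0|exact: mulr_gt0].
pose al := Num.min 1 (Num.min (d / 4) (c / (4 * K) / (2 * (modulus D + 1)))).
have al0 : 0 < al by rewrite !lt_min ltr01 q0 andbT divr_gt0.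
have al1 : al <= 1 by rewrite ge_min lexx.
exists al => [|t]; first by rewrite al0.
have Ha : modulus (H al t - a) <= 2 * al.
  rewrite /H addrC addKr modulusM modulus_real gtr0_norm// mulrC.
  by rewrite ler_wpM2r// ltW.
have ald : 2 * al < d.
  have : al <= d / 4 by rewrite !ge_min lexx orbT.
  lra.
have alq : (modulus D + 1) * (2 * al) <= c / (4 * K).
  have : al <= c / (4 * K) / (2 * (modulus D + 1)) by rewrite !ge_min lexx !orbT.
  by rewrite ler_pdivlMr; lra.
have E : modulus (h (H al t) - h a) <= c / (4 * K).
  have := Hd _ (le_lt_trans Ha ald); rewrite mul1r => HE.
  rewrite (le_trans _ alq)// mulrDl mul1r.
  have -> : h (H al t) - h a = D * (H al t - a) + (h (H al t) - h a - D * (H al t - a)) by ring.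
  rewrite (le_trans (modulusD _ _))// modulusM lerD// ?ler_wpM2l//.
  exact: le_trans HE Ha.
have -> : B al t = c * complex.Re (kappa t) + complex.Re (w * kappa t * (h (H al t) - h a)).
  have -> : c * complex.Re (kappa t) = complex.Re (w * h a * kappa t).
    by rewrite wha [_ * kappa t]mulrC ReM mulrC.
  by rewrite -raddfD; congr complex.Re; ring.
have := Re_le_modulus (w * kappa t * (h (H al t) - h a)).
rewrite (modulusM (w * _)) (modulusM w (kappa t)) w1 mul1r ler_norml => /andP[+ _].
have : modulus (kappa t) * modulus (h (H al t) - h a) <= c / 4.
  apply: (@le_trans _ _ (K * (c / (4 * K)))); first by apply: ler_pM; rewrite ?modulus_ge0.
  have : K != 0 by rewrite gt_eqF.
  by move: K => k k0; rewrite le_eqVlt; apply/orP; left; apply/eqP; field.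
have : c * 2^-1 <= c * complex.Re (kappa t) by rewrite ler_wpM2l// ltW.
lra.
Qed.

Let circle_continuous : continuous (fun t => modulus (h (rC * cis t))).
Proof.
move=> t; apply: (@continuous_comp _ _ _ (fun t => h (rC * cis t)) (fun z : C => modulus z)); last exact: modulus_continuous.
apply: (@continuous_comp _ _ _ (fun t => rC * cis t) h); last first.
  by apply: h_continuous; rewrite modulus_rcis.
by apply: cvgM; [exact: cvg_cst|exact: cis_continuous].
Qed.

Lemma cauchy_bound_rotated : pi * modulus (h a) <= 2 * K * circle_mean.
Proof.
have cm0 : 0 <= circle_mean by apply: Rintegral_ge0 => t _; exact: modulus_ge0.
have [->|/[dup] /modulus_gt0 c0 /near_center [al /andP[al0 al1] Bal]] := eqVneq (h a) 0.
  by rewrite modulus0 mulr0 !mulr_ge0// ltW.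
set c := modulus (h a) in c0 Bal *.
have cB x : 0 <= x <= 1 -> {within `[0, 2 * pi], continuous (B x)}.
  by move=> x01; apply: continuous_subspaceT; exact: B_continuous.
have ccst k : {within `[0, 2 * pi], continuous (cst k : R -> R)}.
  by apply: continuous_subspaceT => x; exact: cvg_cst.
have al01 : 0 <= al <= 1 by rewrite ltW.
have lower : c / 4 * (2 * pi) <= segint 0 (2 * pi) (B 1).
  rewrite (segint_B al0 al1) -[X in _ * X]subr0 -segint_cst//.
  apply: segint_le; [exact: ccst|by apply: cB|by move=> t _; exact: Bal].
have one01 : (0 : R) <= (1 : R) <= (1 : R) by rewrite ler01 lexx.
have upper : segint 0 (2 * pi) (B 1) <= K * circle_mean.
  rewrite /circle_mean /segint -RintegralZl//; last first.
    by apply: segment_integrable; apply: continuous_subspaceT.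
  apply: segint_le => [||t _]; first exact: cB.
    apply: continuous_subspaceT => t; apply: cvgM; first exact: cvg_cst.
    exact: circle_continuous.
  have -> : rC * cis t = H 1 t by rewrite /H mul1r /P addrC subrK.
  rewrite (le_trans (ler_norm _))// (le_trans (Re_le_modulus _))//.
  by rewrite modulusM w1 mul1r modulusM mulrC ler_wpM2r ?modulus_ge0.
lra.
Qed.

End cauchy_bound.

(** The constant is not sharp; it disappears in the power trick of
    [boundary_bound]. *)
Theorem cauchy_bound (R : realType) (h : cplx R -> cplx R) (a : cplx R) (r : R) :
  (forall w, modulus w < 1 -> exists D, cdiff h w D) -> modulus a < r -> r < 1 ->
  modulus (h a) <= 4 / (r - modulus a) *
    ((2 * pi)^-1 * segint 0 (2 * pi) (fun t => modulus (h ((r%:C%C : cplx R) * cis t)))).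
Proof.
move=> hol ar r1; have [w w1 wha] := unimodular_rotation (h a).
have := cauchy_bound_rotated hol ar r1 w1 wha.
set m := segint _ _ _; have pi0 := pi_gt0 R.
rewrite mulrC -ler_pdivlMr// => /le_trans; apply.
have pn0 : pi != 0 :> R by rewrite gt_eqF.
have an0 : r - modulus a != 0 by rewrite gt_eqF// subr_gt0.
rewrite le_eqVlt; apply/orP; left; apply/eqP.
by move: (pi) (r - modulus a) pn0 an0 => p d p0 d0; field; rewrite p0 d0.
Qed.

(** * Means over the torus *)

Section tuple_measurability.
Context (R : realType) (n : nat).

Let grid (N : nat) (t : n.-tuple R) : n.-tuple int :=
  map_tuple (fun x => Num.floor (x * N.+1%:R)) t.

Let node (N : nat) (z : n.-tuple int) : n.-tuple R :=
  map_tuple (fun m : int => m%:~R / N.+1%:R) z.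

Let measurable_grid (N : nat) (Psi : n.-tuple int -> R) :
  measurable_fun [set: n.-tuple (measurableTypeR R)] (Psi \o grid N).
Proof.
move=> _ Y _; rewrite setTI.
have -> : (Psi \o grid N) @^-1` Y = \bigcup_(z : n.-tuple int)
    (if pselect (Y (Psi z)) then [set t : n.-tuple R | grid N t = z] else set0).
  apply/seteqP; split=> [t Yt|t [z _]]; last first.
    by case: pselect => // Yz; rewrite /preimage /= => ->.
  by exists (grid N t) => //; case: pselect.
apply: countable_bigcupT_measurable; first exact: countableP.
move=> z; case: pselect => [Yz|nYz]; last exact: measurable0.
have -> : [set t | grid N t = z] = \bigcap_(i in [set: 'I_n])
    (@tnth n R ^~ i @^-1` `[(tnth z i)%:~R / N.+1%:R, (tnth z i + 1)%:~R / N.+1%:R[%classic).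
  apply/seteqP; split=> [t <- i _|t H].
    rewrite /= in_itv/= tnth_map; have /andP[fl fr] := floor_itv (tnth t i * N.+1%:R).
    by rewrite ler_pdivrMr// ltr_pdivlMr// fl.
  apply: eq_from_tnth => i; rewrite tnth_map; apply/eqP; rewrite floor_eq.
  have := H i I; rewrite /= in_itv/=.
  by rewrite ler_pdivrMr// ltr_pdivlMr.
apply: fin_bigcap_measurable; first exact: finite_finset.
move=> i _; rewrite -[X in measurable X]setTI.
by apply: (@measurable_tnth _ (measurableTypeR R) n i) => //; exact: measurable_itv.
Qed.

(** The sigma-algebra on tuples is generated by the coordinates, so measurability
    is obtained by rounding the coordinates to a grid: this gives functions with
    countably many values, on measurable pieces, that converge pointwise. *)
Lemma measurable_continuous_tuple (F : n.-tuple R -> R) :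
  (forall t (e : R), 0 < e -> exists2 d : R, 0 < d &
    forall t', (forall i, `|tnth t' i - tnth t i| < d) -> `|F t' - F t| < e) ->
  measurable_fun [set: n.-tuple (measurableTypeR R)] F.
Proof.
move=> cF.
apply: (@measurable_fun_cvg _ _ _ _ (fun N => (F \o node N) \o grid N)).
  by move=> N; exact: measurable_grid.
move=> t _; apply/cvgrPdist_lt => e e0.
have [d d0 Hd] := cF t e e0.
near=> N; rewrite distrC; apply: Hd => i; rewrite !tnth_map.
have /andP[fl fr] := floor_itv (tnth t i * N.+1%:R).
have Nd : N.+1%:R^-1 < d by near: N; exact: near_infty_natSinv_lt (PosNum d0).
apply: le_lt_trans Nd.
have N0 : 0 < N.+1%:R :> R by [].
have -> : (Num.floor (tnth t i * N.+1%:R))%:~R / N.+1%:R - tnth t i =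
  ((Num.floor (tnth t i * N.+1%:R))%:~R - tnth t i * N.+1%:R) / N.+1%:R.
  by rewrite mulrBl mulfK// gt_eqF.
rewrite normrM normfV (gtr0_norm N0) ler_piMl ?invr_ge0//.
by move: fl fr; rewrite intrD ler_norml; lra.
Unshelve. all: by end_near. Qed.

End tuple_measurability.

Section torus_mean.
Context (R : realType).
Local Notation C := (cplx R).

Definition unit_polydisc n (z : n.-tuple C) := forall i, modulus (tnth z i) < 1.

Definition tuple_continuous_at n (F : n.-tuple C -> R) (z : n.-tuple C) :=
  forall e : R, 0 < e -> exists2 d : R, 0 < d &
    forall z', (forall i, modulus (tnth z' i - tnth z i) < d) -> `|F z' - F z| < e.

Definition circle n (r : R) (t : n.-tuple R) : n.-tuple C :=
  map_tuple (fun x => (r%:C%C : C) * cis x) t.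

Lemma circle_polydisc n (r : R) (t : n.-tuple R) : 0 <= r < 1 -> unit_polydisc (circle r t).
Proof.
by move=> /andP[r0 r1] i; rewrite tnth_map modulusM modulus_cis mulr1 modulus_real ger0_norm.
Qed.

Lemma measurable_circle n (F : n.-tuple C -> R) (r : R) : 0 <= r < 1 ->
  (forall z, unit_polydisc z -> tuple_continuous_at F z) ->
  measurable_fun [set: n.-tuple (measurableTypeR R)] (fun t => F (circle r t)).
Proof.
move=> r01 cF; apply: (@measurable_continuous_tuple R n (fun t => F (circle r t))) => t e e0.
have [d d0 Hd] := cF _ (circle_polydisc t r01) e e0.
exists (d / 2); first by rewrite divr_gt0.
move=> t' tt'; apply: Hd => i; rewrite !tnth_map -mulrBr modulusM modulus_real.
have /andP[r0 r1] := r01; rewrite ger0_norm//.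
apply: (@le_lt_trans _ _ (modulus (cis (tnth t' i) - cis (tnth t i)))).
  by rewrite ler_piMl ?modulus_ge0// ltW.
by rewrite (le_lt_trans (cis_lip _ _))// mulrC -ltr_pdivlMr.
Qed.

Definition tuple_upd n (z : n.-tuple C) (i : 'I_n) (w : C) : n.-tuple C :=
  [tuple if j == i then w else tnth z j | j < n].

(** Holomorphy in each variable separately is all that the iteration of the
    one-variable estimate uses, and it passes to slices. *)
Definition sep_holo n (G : n.-tuple C -> C) := forall z, unit_polydisc z ->
  forall i, exists D, cdiff (fun w => G (tuple_upd z i w)) (tnth z i) D.

Lemma unit_polydisc_cons n (w : C) (z : n.-tuple C) : modulus w < 1 ->
  unit_polydisc z -> unit_polydisc [tuple of w :: z].
Proof. by move=> w1 z1 i; have [j ->|->] := unliftP ord0 i; rewrite ?tnth0 ?tnthS. Qed.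

Lemma tuple_upd_head n (w w' : C) (z : n.-tuple C) :
  tuple_upd [tuple of w :: z] ord0 w' = [tuple of w' :: z].
Proof.
apply: eq_from_tnth => i; rewrite tnth_mktuple.
by have [j ->|->] := unliftP ord0 i; rewrite ?eqxx ?tnth0 ?tnthS.
Qed.

Lemma tuple_upd_tail n (w w' : C) (z : n.-tuple C) (i : 'I_n) :
  tuple_upd [tuple of w :: z] (lift ord0 i) w' = [tuple of w :: tuple_upd z i w'].
Proof.
apply: eq_from_tnth => j; rewrite tnth_mktuple.
have [k ->|->] := unliftP ord0 j; rewrite ?tnth0 ?tnthS//.
by rewrite (inj_eq lift_inj) tnth_mktuple.
Qed.

Lemma circle_cons n (r x : R) (t : n.-tuple R) :
  circle r [tuple of x :: t] = [tuple of (r%:C%C : C) * cis x :: circle r t].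
Proof. exact: val_inj. Qed.

(** Apply the one-variable estimate to the first coordinate, the induction
    hypothesis to each slice of the remaining ones, and Tonelli's theorem. *)
Theorem torus_bound n (G : n.-tuple C -> C) (rho r : R) (a : n.-tuple C) :
  (forall z, unit_polydisc z -> tuple_continuous_at (fun z => modulus (G z)) z) ->
  sep_holo G -> 0 <= rho -> rho < r -> r < 1 -> (forall i, modulus (tnth a i) <= rho) ->
  ((modulus (G a))%:E <= ((4 / (r - rho)) ^+ n)%:E *
    \int[angle_measure R n]_t (modulus (G (circle r t)))%:E)%E.
Proof.
move=> + + rho0 rhor r1; have r0 : 0 <= r by rewrite (le_trans rho0)// ltW.
have r01 : 0 <= r < 1 by rewrite r0.
set K := 4 / (r - rho); have K0 : 0 < K by rewrite divr_gt0// subr_gt0.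
elim: n => [|n IH] in G a *.
  move=> cG _ _; rewrite expr0 mul1e.
  rewrite /angle_measure integral_dirac//=; last first.
    by apply/measurable_EFinP; exact: (measurable_circle r01 cG).
  by rewrite diracT mul1e !tuple0 (tuple0 (circle _ _)).
move=> cG hG; case/tupleP: a => a0 a ale.
have a0le : modulus a0 <= rho by have := ale ord0; rewrite tnth0.
have ale' i : modulus (tnth a i) <= rho by have := ale (lift ord0 i); rewrite tnthS.
have a1 : unit_polydisc a by move=> i; rewrite (le_lt_trans (ale' i))// (lt_trans rhor).
pose m (x : R) (t : n.-tuple R) := modulus (G [tuple of (r%:C%C : C) * cis x :: circle r t]).
have mG : measurable_fun [set: n.+1.-tuple (measurableTypeR R)]
    (fun t => (modulus (G (circle r t)))%:E).
  by apply/measurable_EFinP; exact: (measurable_circle r01 cG).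
have mm : measurable_fun [set: measurableTypeR R * n.-tuple (measurableTypeR R)]
    (fun p => (m p.1 p.2)%:E).
  have := measurableT_comp mG (@measurable_tuple_cons R n).
  by apply: eq_measurable_fun => -[x t] _; rewrite /= /m -circle_cons.
have m0 p : (0 <= (m p.1 p.2)%:E)%E by rewrite lee_fin modulus_ge0.
have -> : (\int[angle_measure R n.+1]_t (modulus (G (circle r t)))%:E =
  \int[uniform_prob (two_pi_gt0 R)]_x \int[angle_measure R n]_t (m x t)%:E)%E.
  rewrite /= ge0_integral_distribution//; last by move=> t; rewrite lee_fin modulus_ge0.
  transitivity (\int[uniform_prob (two_pi_gt0 R) \x angle_measure R n]_p (m p.1 p.2)%:E)%E.
    by apply: eq_integral => -[x t] _; rewrite /= /m -circle_cons.
  by rewrite fubini_tonelli1.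
have mi : measurable_fun setT (fun x => \int[angle_measure R n]_t (m x t)%:E)%E.
  exact: (measurable_fun_fubini_tonelli_F _ mm m0).
have int0 x : (0 <= \int[angle_measure R n]_t (m x t)%:E)%E.
  by apply: integral_ge0 => t _; rewrite lee_fin modulus_ge0.
have rcis x : modulus ((r%:C%C : C) * cis x) < 1.
  by rewrite modulusM modulus_cis mulr1 modulus_real ger0_norm.
have slice x : ((modulus (G [tuple of (r%:C%C : C) * cis x :: a]))%:E <=
    (K ^+ n)%:E * \int[angle_measure R n]_t (m x t)%:E)%E.
  apply: (IH (fun z => G [tuple of (r%:C%C : C) * cis x :: z])) => // z z1.
    move=> e e0; have [d d0 Hd] := cG _ (unit_polydisc_cons (rcis x) z1) e e0.
    exists d => // z' z'z; apply: Hd => i.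
    by have [j ->|->] := unliftP ord0 i; rewrite ?tnth0 ?tnthS// subrr modulus0.
  move=> i; have [D HD] := hG _ (unit_polydisc_cons (rcis x) z1) (lift ord0 i).
  exists D; rewrite tnthS in HD; move: HD; congr (cdiff _ _ _).
  by apply/funext => w; rewrite tuple_upd_tail.
have hol w : modulus w < 1 -> exists D, cdiff (fun w => G [tuple of w :: a]) w D.
  move=> w1; have [D HD] := hG _ (unit_polydisc_cons w1 a1) ord0.
  exists D; rewrite tnth0 in HD; move: HD; congr (cdiff _ _ _).
  by apply/funext => w'; rewrite tuple_upd_head.
have := cauchy_bound hol (le_lt_trans a0le rhor) r1.
set M := segint _ _ _ => cb.
pose g (x : R) := modulus (G [tuple of (r%:C%C : C) * cis x :: a]).
have cg : continuous g.
  move=> x; apply: (@continuous_comp _ _ _ (fun x => (r%:C%C : C) * cis x) (fun w => modulus (G [tuple of w :: a]))).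
    by apply: cvgM; [exact: cvg_cst|exact: cis_continuous].
  apply: (@continuous_comp _ _ _ (fun w => G [tuple of w :: a]) (fun z : C => modulus z)); last exact: modulus_continuous.
  by have [D /cdiff_continuous] := hol _ (rcis x).
have mg : measurable_fun [set: measurableTypeR R] (fun x => (g x)%:E).
  by apply/measurable_EFinP; exact: continuous_measurable_fun.
have Mint : (((2 * pi)^-1 * M)%:E = \int[uniform_prob (two_pi_gt0 R)]_x (g x)%:E)%E.
  rewrite (integral_uniform (two_pi_gt0 R) mg) => [|x]; last by rewrite lee_fin modulus_ge0.
  rewrite subr0 EFinM; congr (_ * _)%E.
  rewrite /M /segint /Rintegral fineK//.
  by apply: integrable_fin_num => //; apply: segment_integrable; exact: continuous_subspaceT.
have M0 : 0 <= (2 * pi)^-1 * M.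
  rewrite mulr_ge0// ?invr_ge0 ?mulr_ge0 ?pi_ge0//.
  by apply: Rintegral_ge0 => x _; exact: modulus_ge0.
apply: (@le_trans _ _ (K%:E * ((2 * pi)^-1 * M)%:E)%E).
  rewrite -EFinM lee_fin (le_trans cb)// ler_wpM2r//.
  rewrite ler_wpM2l// lef_pV2 ?posrE ?subr_gt0//; last exact: le_lt_trans rhor.
  by rewrite lerD2l lerN2.
rewrite exprS (EFinM K (K ^+ n)) -muleA.
rewrite lee_wpmul2l ?lee_fin ?(ltW K0)//.
rewrite Mint -ge0_integralZl ?lee_fin ?exprn_ge0 ?(ltW K0)//.
apply: ge0_le_integral => //.
- by move=> x _; rewrite lee_fin modulus_ge0.
- exact: measurable_funeM.
- by move=> x _; exact: slice.
Qed.

End torus_mean.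

(** * Boundary values and the maximum principle *)

Section polydisc_functions.
Context (R : realType) (n : nat).
Local Notation C := (cplx R).

Definition row_of_tuple (z : n.-tuple C) : 'rV[C]_n := \row_j tnth z j.

Lemma row_of_tuple_polydisc z : unit_polydisc z -> polydisc (row_of_tuple z).
Proof. by move=> z1 j; rewrite mxE -modulusE ltcR. Qed.

Lemma real_radius (e : C) : 0 < e -> exists2 d : R, 0 < d & e = d%:C%C.
Proof.
move=> e0; exists (modulus e); last by rewrite modulusE gtr0_norm.
by rewrite modulus_gt0// gt_eqF.
Qed.

Lemma continuous_tuple_continuous (F : 'rV[C]_n -> R) (z : n.-tuple C) :
  {for row_of_tuple z, continuous F} ->
  tuple_continuous_at (F \o row_of_tuple) z.
Proof.
move=> /(@cvgrPdist_lt _ _ _ (nbhs (row_of_tuple z))) cF e e0.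
have /nbhs_ballP[e' /real_radius[d d0 ->] Hd] := cF e e0.
exists d => // z' z'z; rewrite distrC; apply: Hd; split=> [|i j]; first by rewrite ltcR.
by rewrite !mxE /ball /= -modulusE ltcR modulus_distC.
Qed.

Lemma derivable_cdiff (f : 'rV[C]_n -> C) (a v : 'rV[C]_n) (g : C -> C) (w : C) :
  derivable f a v -> (forall w', g w' = f ((w' - w) *: v + a)) ->
  exists D, cdiff g w D.
Proof.
move=> /cvg_ex[l /= fl] gE; exists l => e e0.
have /cvg_modulusP/(_ _ e0) := fl.
move=> /nbhs_ballP[e' /real_radius[d d0 ->] Hd].
exists d => // w' w'w; have [->|ww'] := eqVneq w' w.
  by rewrite !subrr mulr0 subr0 modulus0 mulr0.
have d0' : w' - w != 0 by rewrite subr_eq0.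
have := Hd (w' - w); rewrite /ball /= sub0r normrN -modulusE ltcR => /(_ w'w d0').
rewrite -gE -[X in l - _ *: (_ - f X)]add0r -[X in l - _ *: (_ - f (X + _))](scale0r v) -(subrr w) -gE.
move=> /ltW H; have -> : g w' - g w - l * (w' - w) = - (l - (w' - w)^-1 *: (g w' - g w)) * (w' - w).
  by rewrite /GRing.scale /=; field.
by rewrite modulusM modulusN ler_wpM2r ?modulus_ge0.
Qed.

Lemma differentiable_sep_holo (f : 'rV[C]_n -> C) :
  (forall z, polydisc z -> differentiable f z) -> sep_holo (f \o row_of_tuple).
Proof.
move=> df z z1 i.
apply: (@derivable_cdiff f (row_of_tuple z) (delta_mx ord0 i)).
  by apply: diff_derivable; apply: df; exact: row_of_tuple_polydisc.
move=> w' /=; congr f; apply/rowP => j; rewrite !mxE tnth_mktuple eqxx/=.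
by case: eqVneq => [->|ji]; rewrite ?mulr1 ?subrK// mulr0 add0r.
Qed.

(** The power trick: a multiplicative constant independent of the exponent can
    be dropped. *)
Lemma le_of_powers (x L K : R) : 0 <= x -> 0 < L ->
  (forall m, x ^+ m <= K * L ^+ m) -> x <= L.
Proof.
move=> x0 L0 H; rewrite leNgt; apply/negP => Lx.
have xp : 0 < x by exact: lt_trans Lx.
have q1 : `|L / x| < 1 by rewrite ger0_norm ?divr_ge0 ?ltW// ltr_pdivrMr// mul1r.
have K0 : 0 < K by have := H 0%N; rewrite !expr0 mulr1 => /(lt_le_trans ltr01).
have := cvg_expr q1 => /cvgrPdist_lt/(_ K^-1).
rewrite invr_gt0 => /(_ K0)[N _ /(_ N (leqnn N))] /=.
rewrite sub0r normrN ger0_norm ?exprn_ge0 ?divr_ge0 ?ltW//.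
rewrite expr_div_n ltr_pdivrMr ?exprn_gt0// -(ltr_pM2l K0) mulrA mulfV ?gt_eqF// mul1r.
by rewrite ltNge H.
Qed.

(** A maximum principle for radial boundary values prescribed only almost
    everywhere. The constant [K] depends on the point [z] but neither on the
    radius nor on the power [m]. *)
Theorem boundary_bound (f : 'rV[C]_n -> C) (v : 'rV[C]_n -> R) (B L : R) (r : nat -> R) :
  (forall z, polydisc z -> differentiable f z) ->
  (forall z, polydisc z -> {for z, continuous v}) ->
  (forall z, polydisc z -> modulus (f z) <= v z <= B) ->
  0 < L -> (forall k, 0 <= r k < 1) -> r @ \oo --> (1 : R) ->
  {ae angle_measure R n, forall t, v (row_of_tuple (circle (r k) t)) @[k --> \oo] --> L} ->
  forall z, polydisc z -> modulus (f z) <= L.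
Proof.
move=> df cv fv L0 r01 r1 vL z z1.
pose a : n.-tuple C := [tuple z ord0 j | j < n].
have za : z = row_of_tuple a by apply/rowP => j; rewrite mxE tnth_mktuple.
pose rho := \big[Num.max/0]_(j < n) modulus (tnth a j).
have rho0 : 0 <= rho by exact: bigmax_ge_id.
have rho1 : rho < 1.
  apply: bigmax_lt => // j _; rewrite tnth_mktuple.
  by have := z1 j; rewrite -modulusE (ltcR _ 1).
have rhoP i : modulus (tnth a i) <= rho by exact: le_bigmax.
(* [4 / (r k - rho)] is at most [8 / (1 - rho)] as soon as
   [r k > (1 + rho) / 2]. *)
pose K := (8 / (1 - rho)) ^+ n.
apply: (@le_of_powers _ _ K) => // [|m]; first exact: modulus_ge0.
pose fm w := f w ^+ m.
have dfm w : polydisc w -> differentiable fm w.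
  move=> w1; rewrite {}/fm; elim: m => [|j IHj].
    by rewrite (_ : (fun w => f w ^+ 0) = cst 1)//; exact: differentiable_cst.
  rewrite (_ : (fun w => f w ^+ j.+1) = f * (fun w => f w ^+ j)).
    by apply: differentiableM => //; exact: df.
  by apply/funext => x; rewrite exprS.
pose s k := (\int[angle_measure R n]_t (v (row_of_tuple (circle (r k) t)) ^+ m)%:E)%E.
have polyc k t : polydisc (row_of_tuple (circle (r k) t)).
  by apply: row_of_tuple_polydisc; exact: circle_polydisc.
have v0 w : polydisc w -> 0 <= v w.
  by move=> /fv /andP[+ _]; apply: le_trans; exact: modulus_ge0.
have tv w : unit_polydisc w -> tuple_continuous_at ((fun x => v x ^+ m) \o row_of_tuple) w.
  move=> w1; apply: continuous_tuple_continuous; apply: (@continuous_comp _ _ _ v (fun x => x ^+ m)).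
    by apply: cv; exact: row_of_tuple_polydisc.
  exact: exprn_continuous.
have mv k : measurable_fun [set: n.-tuple (measurableTypeR R)]
    (fun t => (v (row_of_tuple (circle (r k) t)) ^+ m)%:E).
  by apply/measurable_EFinP; exact: (measurable_circle (r01 k) tv).
have scvg : s @ \oo --> (L ^+ m)%:E.
  have B0 : 0 <= B.
    by have /fv/andP[_] := polyc 0%N [tuple 0 | _ < n]; apply: le_trans; apply: v0.
  have [] := @dominated_convergence _ _ _ (angle_measure R n) setT measurableT
    (fun k t => (v (row_of_tuple (circle (r k) t)) ^+ m)%:E) (fun=> (L ^+ m)%:E) (fun=> (B ^+ m)%:E).
  - by [].
  - exact: measurable_cst.
  - apply: (@filterS _ _ (ae_filter_ringOfSetsType (angle_measure R n)) _ _ _ vL) => t vt _; apply: cvg_EFin; first by near=> k.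
    exact: (continuous_cvg _ (@exprn_continuous _ m L) vt).
  - exact: finite_measure_integrable_cst.
  - apply: aeW => t k _; rewrite lee_fin ger0_norm ?exprn_ge0 ?v0//.
    by rewrite lerXn2r// ?nnegrE ?v0//; case/andP: (fv _ (polyc k t)).
  move=> _ _; rewrite integral_cst//= probability_setT mule1; exact.
have KC : (K%:E * s k)%E @[k --> \oo] --> (K%:E * (L ^+ m)%:E)%E.
  by apply: cvgeZl.
rewrite -lee_fin EFinM -(cvg_lim _ KC)//.
apply: lime_ge; first by apply/cvg_ex; eexists; exact: KC.
have rr : \forall k \near \oo, (1 + rho) / 2 < r k.
  by move/cvgrPdist_lt: r1 => /(_ ((1 - rho) / 2)); rewrite divr_gt0 ?subr_gt0// => /(_ isT); apply: filterS => k; rewrite ltr_norml; lra.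
near=> k.
have rk : (1 + rho) / 2 < r k by near: k.
have rhor : rho < r k by lra.
have /andP[_ rk1] := r01 k.
have tfm w : unit_polydisc w -> tuple_continuous_at (fun w => modulus (fm (row_of_tuple w))) w.
  move=> w1; apply: (@continuous_tuple_continuous (fun w => modulus (fm w))).
  apply: (@continuous_comp _ _ _ fm (fun z : C => modulus z)); last exact: modulus_continuous.
  by apply: differentiable_continuous; apply: dfm; exact: row_of_tuple_polydisc.
have := @torus_bound R n (fm \o row_of_tuple) rho (r k) a tfm (differentiable_sep_holo dfm) rho0 rhor rk1 rhoP.
rewrite /= -za /fm modulusX => /le_trans; apply.
apply: lee_pmul; rewrite ?lee_fin ?exprn_ge0 ?divr_ge0 ?subr_ge0 ?(ltW rhor)//.
- by apply: integral_ge0 => t _; rewrite lee_fin modulus_ge0.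
- rewrite /K lerXn2r// ?nnegrE ?divr_ge0 ?subr_ge0 ?(ltW rhor) ?(ltW rho1)//.
  rewrite ler_pdivrMr ?subr_gt0// mulrAC ler_pdivlMr ?subr_gt0//; lra.
apply: ge0_le_integral => //.
- by move=> t _; rewrite lee_fin modulus_ge0.
- apply/measurable_EFinP; exact: (measurable_circle (r01 k) tfm).
- move=> t _; rewrite lee_fin modulusX lerXn2r// ?nnegrE ?modulus_ge0 ?v0//.
  by case/andP: (fv _ (polyc k t)).
Unshelve. all: by end_near. Qed.

End polydisc_functions.

(** * Inner functions and M-ideals *)

Section inner_functions.
Context (R : realType) (n : nat).
Local Notation C := (cplx R).
Implicit Types (f g u : Hinf R n).

Lemma Hinf_rnorm_le f (c : R) : 0 <= c ->
  (forall z, polydisc z -> modulus (f z) <= c) -> rnorm f <= c.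
Proof. by move=> c0 fc; rewrite rnorm_le lecR; exact: sup_norm_le. Qed.

Lemma Hinf_modulus_le f z : polydisc z -> modulus (f z) <= rnorm f.
Proof.
by move=> z1; rewrite -lecR rnormE lecR; apply: sup_norm_ub => //; exact: Hinf_bounded.
Qed.

Lemma modulus_Hinf_continuous f z : polydisc z -> {for z, continuous (fun w => modulus (f w))}.
Proof.
move=> z1; apply: (@continuous_comp _ _ _ f (fun z : C => modulus z)); last exact: modulus_continuous.
by apply: differentiable_continuous; have [df _ _] := HinfP f; exact: df.
Qed.

Definition radius (k : nat) : R := 1 - k.+1%:R^-1.

Lemma radius01 k : 0 <= radius k < 1.
Proof. by rewrite /radius subr_ge0 invf_le1// ler1n/= gtrBl invr_gt0. Qed.

Lemma radius_cvg : radius @ \oo --> (1 : R).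
Proof.
rewrite -[X in _ --> X]subr0; apply: cvgB; first exact: cvg_cst.
exact: cvg_harmonic.
Qed.

Lemma radius_cvg_left : radius @ \oo --> (1 : R)^'-.
Proof.
move=> P HP; have : \forall k \near \oo, radius k < 1 -> P (radius k) := radius_cvg HP.
apply: filterS => k; apply.
by case/andP: (radius01 k).
Qed.

Lemma inner_radial u : inner u -> {ae angle_measure R n, forall t,
  modulus (u (row_of_tuple (circle (radius k) t))) @[k --> \oo] --> (1 : R)}.
Proof.
apply: (@filterS _ _ (ae_filter_ringOfSetsType (angle_measure R n))) => t [cu lu].
have -> : (fun k => modulus (u (row_of_tuple (circle (radius k) t)))) =
    (fun z => modulus z) \o radial u (torus_point t) \o radius.
  apply/funext => k /=; rewrite /radial; congr (modulus (u _)).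
  by apply/rowP => j; rewrite !mxE tnth_map.
have -> : (1 : R) = modulus (radial_limit u (torus_point t)).
  by rewrite /modulus lu.
apply: cvg_comp; first exact: radius_cvg_left.
apply: (@cvg_comp _ _ _ (radial u (torus_point t)) (fun z : C => modulus z) _ (nbhs (radial_limit u (torus_point t)))); first exact: cu.
exact: modulus_continuous.
Qed.

Lemma inner_rnorm_le1 u : inner u -> rnorm u <= 1.
Proof.
move=> /inner_radial iu; apply: Hinf_rnorm_le => // z z1.
have [du _ _] := HinfP u.
apply: (@boundary_bound R n u (fun w => modulus (u w)) (rnorm u) 1 radius) => //.
- by move=> w; exact: modulus_Hinf_continuous.
- by move=> w w1; rewrite lexx Hinf_modulus_le.
- exact: radius01.
- exact: radius_cvg.
Qed.

Lemma parallelogram (z w : C) : modulus (z + w) ^+ 2 + modulus (z - w) ^+ 2 =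
  2 * (modulus z ^+ 2 + modulus w ^+ 2).
Proof. by rewrite !modulus_sq; case: z w => [a b] [c d] /=; ring. Qed.

(** The dominating function is [sqrt ((1 + eps)^2 - |u|^2)], given by the
    parallelogram law; its radial limits are [sqrt (2 eps + eps^2)] because [u]
    is inner. *)
Lemma inner_two_ball u g (eps : R) : inner u -> 0 < eps ->
  rnorm (g + u) <= 1 + eps -> rnorm (g - u) <= 1 + eps ->
  rnorm g <= Num.sqrt (2 * eps + eps ^+ 2).
Proof.
move=> iu eps0 gu1 gu2.
have e0 : 0 < 2 * eps + eps ^+ 2 by rewrite addr_gt0 ?mulr_gt0 ?exprn_gt0.
apply: Hinf_rnorm_le => [|z z1]; first exact: sqrtr_ge0.
have [dg _ _] := HinfP g.
pose v w : R := Num.sqrt ((1 + eps) ^+ 2 - modulus (u w) ^+ 2).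
have gv w : polydisc w -> modulus (g w) ^+ 2 <= (1 + eps) ^+ 2 - modulus (u w) ^+ 2.
  move=> w1; rewrite lerBrDr.
  have H1 : modulus (g w + u w) ^+ 2 <= (1 + eps) ^+ 2.
    rewrite lerXn2r ?nnegrE ?modulus_ge0 ?addr_ge0 ?(ltW eps0)//.
    exact: le_trans (Hinf_modulus_le (g + u) w1) gu1.
  have H2 : modulus (g w - u w) ^+ 2 <= (1 + eps) ^+ 2.
    rewrite lerXn2r ?nnegrE ?modulus_ge0 ?addr_ge0 ?(ltW eps0)//.
    exact: le_trans (Hinf_modulus_le (g - u) w1) gu2.
  have := parallelogram (g w) (u w); lra.
have cv (s : R) : {for s, continuous (fun s : R => Num.sqrt ((1 + eps) ^+ 2 - s ^+ 2))}.
  apply: (@continuous_comp _ _ _ (fun s : R => (1 + eps) ^+ 2 - s ^+ 2 : R) (@Num.sqrt R)); last exact: sqrt_continuous.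
  by apply: cvgB; [exact: cvg_cst|exact: exprn_continuous].
apply: (@boundary_bound R n g v (1 + eps) _ radius) => //.
- move=> w w1; apply: (@continuous_comp _ _ _ (fun w => modulus (u w)) (fun s : R => Num.sqrt ((1 + eps) ^+ 2 - s ^+ 2))); last exact: cv.
  exact: modulus_Hinf_continuous.
- move=> w w1; apply/andP; split.
    by rewrite -[leLHS]ger0_norm ?modulus_ge0// -sqrtr_sqr ler_wsqrtr// gv.
  rewrite -[leRHS]ger0_norm ?addr_ge0 ?(ltW eps0)// -sqrtr_sqr ler_wsqrtr//.
  by rewrite gerBl sqr_ge0.
- by rewrite sqrtr_gt0.
- exact: radius01.
- exact: radius_cvg.
apply: (@filterS _ _ (ae_filter_ringOfSetsType (angle_measure R n)) _ _ _ (inner_radial iu)) => t ut.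
have -> : 2 * eps + eps ^+ 2 = (1 + eps) ^+ 2 - 1 ^+ 2 by ring.
exact: (continuous_cvg _ (cv 1) ut).
Qed.

End inner_functions.

Lemma sqrt_defect_small (R : realType) (q : R) : 0 < q ->
  exists2 eps : R, 0 < eps & Num.sqrt (2 * eps + eps ^+ 2) < q.
Proof.
move=> q0; pose eps := Num.min 1 (q ^+ 2 / 4).
have eps0 : 0 < eps by rewrite lt_min ltr01 divr_gt0// exprn_gt0.
exists eps => //.
rewrite -[ltRHS]ger0_norm ?(ltW q0)// -sqrtr_sqr ltr_sqrt ?exprn_gt0//.
have e1 : eps <= 1 by rewrite ge_min lexx.
have e2 : eps <= q ^+ 2 / 4 by rewrite ge_min lexx orbT.
have : eps ^+ 2 <= eps by rewrite expr2 ler_piMl// ltW.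
have : 0 < q ^+ 2 by rewrite exprn_gt0.
lra.
Qed.

Lemma closed_subspace_full (R : realType) (X : normedModType (cplx R)) (J : set X) :
  closed_subspace J ->
  (forall (x : X) (q : R), rnorm x <= 1 -> 0 < q -> exists2 y, J y & rnorm (x - y) < q) ->
  J = [set: X].
Proof.
move=> [clJ _ JL] approx; apply/seteqP; split=> // x _.
have J0 : J 0.
  have [|y Jy _] := approx 0 1 _ ltr01; first by rewrite /rnorm normr0 modulus0.
  by rewrite -(addNr y) -scaleN1r; exact: JL.
apply: clJ => A /nbhs_ballP[e /real_radius[d d0 ->] dA].
pose c : R := 1 + rnorm x.
have c0 : 0 < c by rewrite ltr_wpDr// rnorm_ge0.
pose cC : cplx R := c%:C%C.
have cC0 : cC != 0 by apply/eqP => /(@complexI R) c00; move: c0; rewrite c00 ltxx.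
have mcC : modulus cC = c by rewrite modulus_real gtr0_norm.
have x1 : rnorm (cC^-1 *: x) <= 1.
  by rewrite rnormZ modulusV mcC mulrC ler_pdivrMr// mul1r /c lerDr.
have [y Jy xy] := approx _ (d / c) x1 (divr_gt0 d0 c0).
exists (cC *: y); split; first by rewrite -[_ *: _]addr0; exact: JL.
apply: dA; rewrite -ball_normE /ball_ /= -rnormE ltcR.
have -> : x - cC *: y = cC *: (cC^-1 *: x - y).
  by rewrite scalerBr scalerA divff// scale1r.
by rewrite rnormZ mcC mulrC -ltr_pdivlMr.
Qed.

Theorem corollary5p2 (R : realType) (n : nat) (J : set (Hinf R n)) :
  (1 <= n)%N -> M_ideal J -> J <> [set 0] -> J <> [set: Hinf R n] ->
  forall u : Hinf R n, inner u -> ~ J u.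
Proof.
move=> _ MJ _ JT u iu Ju; apply: JT; apply: closed_subspace_full MJ.1 _ => f q f1 q0.
have [eps eps0 epsq] := sqrt_defect_small q0.
have [e Je [H1 H2]] := M_ideal_two_ball MJ Ju f1 (inner_rnorm_le1 iu) eps0.
exists e => //; apply: le_lt_trans epsq.
have E1 : f - e + u = f + u - e := addrAC f (- e) u.
have E2 : f - e - u = f - u - e := addrAC f (- e) (- u).
apply: (inner_two_ball iu eps0).
  by rewrite E1; exact: ltW.
by rewrite E2; exact: ltW.
Qed.
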